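(* Let $f$ be a graph invariant such that $f(G\setminus v)\le f(G)\le f(G\setminus v)+1$ for every graph $G$ and every vertex $v\in V(G)$. Define the graph parameter $\mathsf{tree}\text{-}f(G)=\min_{(T,\{X_t\}_{t\in V(T)})}\max_{t\in V(T)} f(G[X_t])$, where the minimum ranges over all tree decompositions $(T,\{X_t\}_{t\in V(T)})$ of $G$. Then either (1) there exists a function $g$ such that $\mathsf{tree}\text{-}\alpha(G)\le g(\mathsf{tree}\text{-}f(G))$ for every graph $G$, or (2) Maximum Independent Set is para-NP-hard parameterized by $\mathsf{tree}\text{-}f$.
   Context: A graph invariant is a mapping from the class of all graphs to the nonnegative integers taking equal values on isomorphic graphs. A tree decomposition of $G$ is a tree $T$ with bags $X_t\subseteq V(G)$ such that every vertex is in some bag, every edge has both endpoints in some bag, and for each vertex the nodes containing it form a subtree. $\mathsf{tree}\text{-}\alpha(G)$ is the parameter defined as $\mathsf{tree}\text{-}f$ with $f$ replaced by the independence number $\alpha$. Maximum Independent Set asks for the maximum size of an independent set in a given graph (decision version: whether it is at least a given number). Para-NP-hard parameterized by a parameter $p$ means NP-hard already on inputs whose parameter value $p$ is bounded by some fixed constant. *)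

(* Defs.v *)
From HB Require Import structures.
From mathcomp Require Import all_boot all_order all_algebra.
From mathcomp Require Import boolp.

Set Implicit Arguments.
Unset Strict Implicit.
Unset Printing Implicit Defensive.

(* Finite simple graphs; the graph without vertices is included, so that
   deleting a vertex is always possible. *)
Record sgraph := SGraph {
  vertex :> finType;
  adj : rel vertex;
  adj_sym : symmetric adj;
  adj_irr : irreflexive adj }.

Definition isomorphic (G H : sgraph) : Prop :=
  exists2 h : G -> H, bijective h & forall x y, adj (h x) (h y) = adj x y.

Definition graph_invariant (f : sgraph -> nat) : Prop :=
  forall G H, isomorphic G H -> f G = f H.

Section Induced.
Variables (G : sgraph) (X : {set G}).

Definition induced_adj : rel {x : G | x \in X} :=
  fun x y => adj (val x) (val y).

Fact induced_sym : symmetric induced_adj.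
Proof. by move=> x y; apply: adj_sym. Qed.

Fact induced_irr : irreflexive induced_adj.
Proof. by move=> x; apply: adj_irr. Qed.

Definition induced : sgraph := SGraph induced_sym induced_irr.
End Induced.

Definition del_vertex (G : sgraph) (v : G) : sgraph := induced (~: [set v]).

Definition independent (G : sgraph) (S : {set G}) : bool :=
  [forall x in S, forall y in S, ~~ adj x y].

Definition alpha (G : sgraph) : nat :=
  \max_(S : {set G} | independent S) #|S|.

(* [ucycle] also holds of closed sequences with two vertices, i.e. of an edge
   traversed back and forth; a cycle of a simple graph has at least three. *)
Definition is_tree (T : sgraph) : Prop :=
  [/\ 0 < #|T|,
      forall x y : T, connect (@adj T) x y &
      forall c : seq T, ucycle (@adj T) c -> size c <= 2].

Record tree_decomposition (G T : sgraph) (X : T -> {set G}) : Prop :=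
  TreeDecomposition {
    td_tree : is_tree T;
    td_vertex : forall v : G, exists t, v \in X t;
    td_edge : forall u v : G, adj u v -> exists t, (u \in X t) && (v \in X t);
    td_subtree : forall v : G, is_tree (induced [set t | v \in X t]) }.

Definition dec_width (f : sgraph -> nat) (G T : sgraph) (X : T -> {set G})
  : nat := \max_(t : T) f (induced (X t)).

Definition has_dec_width (f : sgraph -> nat) (G : sgraph) (m : nat) : Prop :=
  exists (T : sgraph) (X : T -> {set G}),
    tree_decomposition X /\ dec_width f X = m.

Lemma has_dec_width_ex (f : sgraph -> nat) (G : sgraph) :
  exists m, `[< has_dec_width f G m >].
Proof.
have K1sym : symmetric (fun _ _ : unit => false) by [].
have K1irr : irreflexive (fun _ : unit => fun _ : unit => false) by [].
pose K1 := SGraph K1sym K1irr; pose X (_ : K1) := [set: G].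
exists (dec_width f X); apply/asboolP; exists K1, X; split=> //.
have cyc (H : sgraph) (c : seq H) :
  (forall x y : H, x = y) -> ucycle (@adj H) c -> size c <= 2.
  move=> H1; case: c => [|x [|y [|z c]]] //.
  by rewrite /ucycle /= (H1 x y) adj_irr.
split.
- split; [by rewrite card_unit | by case=> [] [] | by move=> c; apply: cyc; do 2!case].
- by move=> v; exists tt; rewrite in_setT.
- by move=> u v _; exists tt; rewrite !in_setT.
- move=> v; have H1 (x y : induced [set t | v \in X t]) : x = y.
    by apply: val_inj; case: (val x) (val y) => [] [].
  split=> [|x y|c]; [| by rewrite (H1 x y) connect0 | exact: cyc].
  have Xtt : tt \in [set t | v \in X t] by rewrite !inE.
  by apply/card_gt0P; exists (exist _ tt Xtt).
Qed.

Definition tree_param (f : sgraph -> nat) (G : sgraph) : nat :=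
  ex_minn (has_dec_width_ex f G).

Inductive move := MoveL | MoveR | Stay.

(* [None] is the blank symbol, [Some (inl b)] an input/output bit, and
   [Some (inr a)] an auxiliary working symbol. *)
Definition sym (A : finType) : finType := option (bool + A)%type.

(* [trans] gives the next state and, for each tape, the symbol to write and the
   direction in which to move the head afterwards. *)
Record machine := Machine {
  tapes : nat;
  aux : finType;
  state : finType;
  start : state;
  halting : pred state;
  trans : state -> {ffun 'I_tapes.+1 -> sym aux} ->
          state * ('I_tapes.+1 -> sym aux * move) }.

(* A two-way infinite tape: [tleft] lists the cells to the left of the head,
   nearest first, and [tright] the scanned cell and those to its right; the
   cells that are not listed are blank. *)
Record tape (A : finType) := Tape { tleft : seq (sym A); tright : seq (sym A) }.

Section Tape.
Variable A : finType.
Implicit Type t : tape A.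

Definition tread t : sym A := head None (tright t).

Definition twrite t (s : sym A) : tape A :=
  Tape (tleft t) (s :: behead (tright t)).

Definition tmove t (d : move) : tape A :=
  match d with
  | MoveL => Tape (behead (tleft t)) (head None (tleft t) :: tright t)
  | MoveR => Tape (tread t :: tleft t) (behead (tright t))
  | Stay => t
  end.

Definition tload (w : seq bool) : tape A :=
  Tape [::] [seq Some (inl b) | b <- w].

Fixpoint bit_prefix (s : seq (sym A)) : seq bool :=
  if s is Some (inl b) :: s' then b :: bit_prefix s' else [::].
End Tape.

Section Run.
Variable M : machine.

Record config := Config {
  cstate : state M;
  ctape : 'I_(tapes M).+1 -> tape (aux M) }.

Definition step (c : config) : config :=
  if halting (cstate c) then c else
  let: (q, act) := trans (cstate c) [ffun i => tread (ctape c i)] in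
  Config q (fun i => tmove (twrite (ctape c i) (act i).1) (act i).2).

(* The i-th argument is written on the i-th tape, with the head on its first
   symbol; the remaining tapes are blank. *)
Definition initial (ws : seq (seq bool)) : config :=
  Config (start M) (fun i => tload (aux M) (nth [::] ws i)).

(* The output is the maximal word of bits on the last tape, read from the
   position of the head to the right. *)
Definition output (c : config) : seq bool :=
  bit_prefix (tright (ctape c ord_max)).

Definition halts_in (t : nat) (ws : seq (seq bool)) (w : seq bool) : Prop :=
  let c := iter t step (initial ws) in halting (cstate c) /\ output c = w.
End Run.

Definition poly_time (h : seq bool -> seq bool) : Prop :=
  exists (M : machine) (p : {poly nat}),
    forall x, halts_in M (p.[size x])%R [:: x] (h x).

Definition poly_time_pred2 (V : seq bool -> seq bool -> bool) : Prop :=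
  exists (M : machine) (p : {poly nat}),
    forall x y, halts_in M (p.[size x + size y])%R [:: x; y] [:: V x y].

Definition in_NP (L : seq bool -> Prop) : Prop :=
  exists (V : seq bool -> seq bool -> bool) (q : {poly nat}),
    poly_time_pred2 V /\
    forall x, L x <-> exists2 y, (size y <= q.[size x]%R)%N & V x y.

(* Decision problems have an abstract type [I] of instances; [enc w i] says that
   the word [w] encodes the instance [i]. Hardness on the instances satisfying
   [dom] is with respect to polynomial-time many-one reductions all of whose
   values, for yes- and for no-inputs, encode instances satisfying [dom]. *)
Definition NP_hard_on (I : Type) (enc : seq bool -> I -> Prop)
    (yes dom : I -> Prop) : Prop :=
  forall L, in_NP L ->
    exists2 h, poly_time h &
      forall x, exists i, [/\ enc (h x) i, dom i & L x <-> yes i].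

Definition para_NP_hard (I : Type) (enc : seq bool -> I -> Prop)
    (yes : I -> Prop) (par : I -> nat) : Prop :=
  exists c, NP_hard_on enc yes (fun i => par i <= c).

(* An instance is a graph with a threshold k. It is encoded, along any
   enumeration of the n vertices, by n in unary, the n * n bits of the adjacency
   matrix, and k in unary. *)
Definition mis_enc (w : seq bool) (i : sgraph * nat) : Prop :=
  exists2 s : seq i.1, perm_eq s (enum i.1) &
    w = nseq (size s) true ++ false ::
        [seq adj u v | u <- s, v <- s] ++ nseq i.2 true.

Definition mis_yes (i : sgraph * nat) : Prop := i.2 <= alpha i.1.

(* Main.v *)
Require Import Defs.
From mathcomp Require Import all_boot all_order all_algebra.
From mathcomp Require Import boolp zify.

Set Implicit Arguments.
Unset Strict Implicit.
Unset Printing Implicit Defensive.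

(* If f does not bound the independence number, then, f being monotone under
   induced subgraphs, some constant c bounds f on all edgeless graphs, and
   f <= c + 4 on graphs with at most four vertices.  Subdividing every
   edge of a graph H twice yields a graph with a star decomposition, whose center
   is the edgeless set V(H) and whose other bags have four vertices; and the
   independence number increases by a known amount.  So it remains to reduce an
   arbitrary language of NP to the independence number of some H, by a machine
   that writes down the subdivision of H.

   The vertices of H are the pairs of a cell (t, z) of the computation tableau of
   the verifier and a possible content of that cell; two of them are in conflict
   if they give different contents to one cell or violate a local constraint.
   The contents are indexed by the distance z to the head, not by the absolute
   position on the tape, so that all constraints are binary.  An independent set
   with as many vertices as there are cells is an accepting computation.

   The adjacency of two vertices depends only on equalities, successors and
   comparisons between their coordinates and on bits of the input.  A machine
   can therefore output the adjacency matrix in nested loops over the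
   coordinates, each held in unary as the position of a head on its own tape. *)

(** * Bounding tree-alpha, or bounding f on edgeless graphs *)

Section Invariant.
Variable f : sgraph -> nat.
Hypothesis f_invariant : graph_invariant f.
Hypothesis f_del : forall (G : sgraph) (v : G),
  f (del_vertex v) <= f G <= f (del_vertex v) + 1.

Lemma isomorphic_induced_del (G : sgraph) (X : {set G}) (v : G) : v \notin X ->
  isomorphic (@induced (del_vertex v) [set u | val u \in X]) (induced X).
Proof.
move=> vX.
pose h (u : @induced (del_vertex v) [set u | val u \in X]) : induced X :=
  exist _ (val (val u)) (etrans (esym (in_set _ _)) (valP u)).
have memv (w : induced X) : val w \in ~: [set v].
  by rewrite !inE; apply: contraNneq vX => <-; apply: valP.
have memX (w : induced X) :
    (exist _ (val w) (memv w) : del_vertex v) \in [set u | val u \in X].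
  by rewrite inE; apply: (valP w).
exists h => //.
exists (fun w => exist (fun u : del_vertex v => u \in [set u | val u \in X]) _ (memX w)).
- by move=> u; do 2!apply: val_inj.
- by move=> w; apply: val_inj.
Qed.

(** The vertices outside [X] are deleted one at a time. Invariance of [f] is used because each
    deletion changes the vertex type. *)
Lemma f_induced (G : sgraph) (X : {set G}) : f (induced X) <= f G.
Proof.
have [n] := ubnP #|~: X|; elim: n G X => // n IH G X.
have [XT _|] := eqVneq (~: X) set0.
  suff /f_invariant -> : isomorphic (induced X) G by [].
  have memX v : v \in X by rewrite -[X]setCK XT !inE.
  by exists val => //; exists (fun v => exist (fun v => v \in X) v (memX v)) => v //; apply: val_inj.
case/set0Pn => v; rewrite inE => vX leX.
rewrite -(f_invariant (isomorphic_induced_del vX)).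
have /andP[le _] := f_del v; apply: leq_trans le; apply: IH.
have : #|~: [set u : del_vertex v | val u \in X]| < #|~: X|.
  rewrite -(card_imset _ val_inj); apply: proper_card; apply/properP; split.
    by apply/subsetP => u /imsetP[w]; rewrite !inE => ? ->.
  exists v; rewrite ?inE //; apply/imsetP => -[w _ vw].
  by have := valP w; rewrite -vw !inE eqxx.
by move=> lt; apply: leq_trans lt leX.
Qed.

Definition edgeless (G : sgraph) := forall x y : G, ~~ adj x y.

Lemma isomorphic_edgeless (G H : sgraph) :
  edgeless G -> edgeless H -> #|G| = #|H| -> isomorphic G H.
Proof.
move=> eG eH E; exists (fun x => enum_val (cast_ord E (enum_rank x))).
  exists (fun y => enum_val (cast_ord (esym E) (enum_rank y))) => x;
  by rewrite enum_valK ?cast_ordK ?cast_ordKV enum_rankK.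
by move=> x y; rewrite (negPf (eG _ _)) (negPf (eH _ _)).
Qed.

Lemma alphaP (G : sgraph) k :
  (exists2 S : {set G}, independent S & k <= #|S|) <-> k <= alpha G.
Proof.
split=> [[S indS le]|le].
  by apply: leq_trans le _; apply: (leq_bigmax_cond (F := fun S : {set G} => #|S|)).
have ind0 : independent (set0 : {set G}) by apply/forall_inP => x; rewrite inE.
move: le; rewrite /alpha (bigmax_eq_arg set0) //.
by case: arg_maxnP => // S indS _ le; exists S.
Qed.

(** Deleting a vertex lowers [f] by at most 1, and once all are deleted the graph is edgeless. *)
Lemma f_le_card c (G : sgraph) :
  (forall H, edgeless H -> f H <= c) -> f G <= c + #|G|.
Proof.
move=> fc; have [n] := ubnP #|G|; elim: n G => // n IH G leG.
case: (posnP #|G|) => [G0|/card_gt0P[v _]].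
  by rewrite G0 addn0; apply: fc => x; have := card0_eq G0 x.
have /andP[_ le] := f_del v.
have cd : #|del_vertex v| = #|G|.-1.
  by rewrite card_sig -(cardsC1 v); apply: eq_card => u; rewrite !inE.
have G0 : 0 < #|G| by apply/card_gt0P; exists v.
have := IH (del_vertex v); rewrite cd; lia.
Qed.

(** If for some [c] the graphs with [f G <= c] have unbounded independence number, every edgeless
    graph is isomorphic to an induced subgraph of one of them, and monotonicity bounds [f] by [c] on
    it. *)
Lemma alpha_dichotomy :
  (exists g : nat -> nat, forall G, alpha G <= g (f G)) \/
  (exists c, forall G, edgeless G -> f G <= c).
Proof.
case: (pselect (forall c, exists b, forall G, f G <= c -> alpha G <= b)) => [H|].
  have [g Hg] := choice H; left; exists g => G; exact: Hg.
move/existsNP => [c /forallNP Hc]; right; exists c => H eH.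
have /existsNP[G /not_implyP[fG]] := Hc #|H|.
move/negP; rewrite -ltnNge => /ltnW/alphaP[S indS leS].
(* The independent set is cut down to exactly [#|H|] vertices, since edgeless graphs of equal order
   are isomorphic. *)
have [X XS cX] : exists2 X : {set G}, X \subset S & #|X| = #|H|.
  exists [set x in take #|H| (enum S)].
    by apply/subsetP => u; rewrite inE => /mem_take; rewrite mem_enum.
  by rewrite cardsE (card_uniqP _) ?take_uniq ?enum_uniq // size_takel // -cardE.
have eX : edgeless (induced X).
  move=> x y; have /forall_inP/(_ (val x)) := indS.
  rewrite (subsetP XS) ?(valP x) // => /(_ isT)/forall_inP; apply.
  by rewrite (subsetP XS) ?(valP y).
rewrite -(f_invariant (isomorphic_edgeless eX eH _)); last first.
  by rewrite card_sig -cX; apply: eq_card => u; rewrite !inE.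
exact: leq_trans (f_induced X) fG.
Qed.

Lemma tree_param_le (h : sgraph -> nat) (G T : sgraph) (X : T -> {set G}) k :
  tree_decomposition X -> (forall t, h (induced (X t)) <= k) -> tree_param h G <= k.
Proof.
move=> td le; rewrite /tree_param; case: ex_minnP => m _ min.
apply: leq_trans (min (dec_width h X) _) _; first by apply/asboolP; exists T, X.
by apply/bigmax_leqP.
Qed.

(** The bags of a decomposition that is optimal for [f] have bounded [alpha]. The maximum replaces
    [g], which need not be monotone. *)
Lemma tree_alpha_le g : (forall G, alpha G <= g (f G)) ->
  forall G, tree_param alpha G <= \max_(i < (tree_param f G).+1) g i.
Proof.
move=> Hg G; have : has_dec_width f G (tree_param f G).
  by rewrite /tree_param; case: ex_minnP => m /asboolP.
case=> T [X [td <-]]; apply: tree_param_le td _ => t; apply: leq_trans (Hg _) _.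
have lt : f (induced (X t)) < (dec_width f X).+1.
  by rewrite ltnS; apply: (leq_bigmax (F := fun t => f (induced (X t)))).
exact: (leq_bigmax (F := fun i : 'I__ => g i) (Ordinal lt)).
Qed.
End Invariant.

(** * The doubly subdivided conflict graph *)

Section Star.
Variable L : finType.

Definition star_adj : rel (option L) := fun s t => (s == None) != (t == None).

Fact star_sym : symmetric star_adj.
Proof. by move=> s t; rewrite /star_adj eq_sym. Qed.

Fact star_irr : irreflexive star_adj.
Proof. by move=> s; rewrite /star_adj eqxx. Qed.

Definition star : sgraph := SGraph star_sym star_irr.

(** One of two adjacent vertices is the center, so a cycle with at least three vertices would visit
    the center twice. *)
Lemma star_acyclic (c : seq star) : ucycle (@adj star) c -> size c <= 2.
Proof.
case: c => [|s [|t [|u c]]] //; rewrite /ucycle /= rcons_path.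
move=> /andP[/and4P[st tu _ cs]] /= /and3P[].
rewrite !inE !negb_or => /and3P[_ su sc] /andP[tu' tc] _.
case: t st tu tc tu' => [t|] st tu tc _.
  by case: s u st tu su {cs sc} => [s|] [u|].
case: s st su cs sc => [s|//] _ _ cs sc.
by move: (mem_last u c) tc tu; rewrite inE; case: (last u c) cs => // _ /orP[/eqP<-|->].
Qed.

Lemma induced_star_is_tree (A : {set star}) t : t \in A ->
  (None \in A) || (A == [set t]) -> is_tree (induced A).
Proof.
move=> tA treeA; split.
- by apply/card_gt0P; exists (exist _ t tA).
- move=> x y; case/orP: treeA => [nA|/eqP At]; last first.
    have val_t (w : induced A) : val w = t.
      by apply/eqP; rewrite -in_set1 -At; apply: (valP w).
    have -> : x = y; last exact: connect0.
    by apply: val_inj; rewrite !val_t.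
  pose z : induced A := exist _ (None : star) nA.
  have conn (w : induced A) : connect (@adj (induced A)) w z.
    have [->|wz] := eqVneq w z; first exact: connect0.
    apply: connect1; rewrite /= /induced_adj /= /star_adj eqxx.
    by case: (val w =P None) wz => // wN /eqP[]; apply: val_inj.
  apply: connect_trans (conn x) _.
  by rewrite (sym_connect_sym (@adj_sym _)); apply: conn.
- move=> c /andP[cc uc]; rewrite -(size_map val); apply: star_acyclic.
  rewrite /ucycle map_inj_uniq ?uc ?andbT; last exact: val_inj.
  by case: c cc {uc} => //= x c; rewrite -map_rcons path_map.
Qed.

Lemma star_is_tree : is_tree star.
Proof.
split; first by apply/card_gt0P; exists None.
  have conn (w : star) : connect (@adj star) w None.
    by case: w => [w|]; rewrite ?connect0 //; apply: connect1.
  move=> x y; apply: connect_trans (conn x) _.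
  by rewrite (sym_connect_sym star_sym); apply: conn.
exact: star_acyclic.
Qed.
End Star.

Section Gadget.
Variables (V : finType) (R : rel V).

(* (u, u, None) stands for u; (u, v, None) with u != v is isolated;
   (u, v, Some false) and (u, v, Some true) are adjacent, and are the inner
   vertices of a path of length 3 from u to v if R u v.  They are present for all
   u and v, so that the independence number grows by a fixed amount. *)
Definition gvertex : finType := (V * V * option bool)%type.

(** Each edge is oriented to halve the case analyses. A loop [R u u] yields a triangle, where
    choosing [u] costs an inner vertex. *)
Definition garc (s t : gvertex) : bool :=
  match s.2, t.2 with
  | Some false, Some true => (s.1.1 == t.1.1) && (s.1.2 == t.1.2)
  | Some b, None => [&& R s.1.1 s.1.2, t.1.1 == t.1.2
                      & t.1.1 == (if b then s.1.2 else s.1.1)]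
  | _, _ => false
  end.

Definition gadj : rel gvertex := fun s t => garc s t || garc t s.

Fact gadj_sym : symmetric gadj.
Proof. by move=> s t; rewrite /gadj orbC. Qed.

Fact gadj_irr : irreflexive gadj.
Proof. by case=> [[u v] [[]|]]; rewrite /gadj. Qed.

Definition gadget : sgraph := SGraph gadj_sym gadj_irr.

Definition gbag (t : star (V * V)%type) : {set gadget} :=
  if t is Some (u, v) then
    [set (u, u, None); (v, v, None); (u, v, Some false); (u, v, Some true)]
  else [set s : gadget | s.2 == None].

(** An inner vertex lies in the bag of its own leaf only; every other vertex is in the central bag,
    which connects the nodes containing it. *)
Lemma gadget_decomposition : tree_decomposition gbag.
Proof.
have garc_bag s t : garc s t -> exists r, (s \in gbag r) && (t \in gbag r).
  case: s t => [[u v] o] [[u' v'] o'] /=.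
  case: o o' => [[]|] [[]|] //=.
  - case/and3P=> _ /eqP/= <- /eqP/= ->; exists (Some (u, v)).
    by rewrite !inE !eqxx !orbT.
  - case/andP=> /eqP/= <- /eqP/= <-; exists (Some (u, v)).
    by rewrite !inE !eqxx !orbT.
  - case/and3P=> _ /eqP/= <- /eqP/= ->; exists (Some (u, v)).
    by rewrite !inE !eqxx !orbT.
split.
- exact: star_is_tree.
- case=> [[u v] [b|]]; last by exists None; rewrite inE.
  by exists (Some (u, v)); rewrite !inE; case: b; rewrite eqxx ?orbT.
- move=> s t /orP[/garc_bag[r st]|/garc_bag[r ts]]; exists r => //.
  by rewrite andbC.
- case=> [[u v] [b|]]; last first.
    by apply: (@induced_star_is_tree _ _ None); rewrite !inE.
  apply: (@induced_star_is_tree _ _ (Some (u, v))).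
    by rewrite !inE; case: b; rewrite eqxx ?orbT.
  apply/orP; right; apply/eqP/setP => -[[u' v']|]; rewrite !inE //.
  rewrite !xpair_eqE !andbF /= [RHS]/eq_op /= xpair_eqE ![_ == u]eq_sym ![_ == v]eq_sym.
  by case: b; rewrite ?andbT ?andbF ?orbF ?orFb.
Qed.

Lemma gbag_edgeless : edgeless (induced (gbag None)).
Proof.
case=> [[[u v] o] /= sb] [[[u' v'] o'] /= tb]; rewrite /induced_adj /= /gadj.
by move: sb tb; rewrite !inE => /eqP/= -> /eqP/= ->.
Qed.

Lemma card_gbag u v : #|induced (gbag (Some (u, v)))| <= 4.
Proof.
have -> : #|induced (gbag (Some (u, v)))| = #|gbag (Some (u, v))|.
  by rewrite card_sig; apply: eq_card => s; rewrite !inE.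
apply: leq_trans (card_size [:: (u, u, None); (v, v, None); (u, v, Some false);
  (u, v, Some true) : gvertex]).
by apply: subset_leq_card; apply/subsetP => s; rewrite !inE !orbA.
Qed.

(** * Counting the vertices of independent sets in the gadget *)

Section Counting.
Variable sel : pred V.

(** A set whose cardinality is the threshold of the instance, where [#|sel|] is the size wanted of
    an independent set for [R]. Being a set of vertices, it lets a machine write the threshold in
    unary while running through the vertices. *)
Definition counted (s : gvertex) : bool :=
  if s.2 is Some b then ~~ b else (s.1.1 != s.1.2) || sel s.1.1.

Lemma card_gvertex (P : pred gvertex) : #|P| =
  \sum_u \sum_v (P (u, v, None) + (P (u, v, Some false) + P (u, v, Some true))).
Proof.
rewrite -sum1_card big_mkcond pair_big /=.
rewrite (eq_bigr (fun s => P (s.1, s.2) : nat)); last by case.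
rewrite -(pair_big xpredT xpredT (fun (p : V * V) o => (P (p, o) : nat))) /=.
apply: eq_bigr => -[u v] _ /=; rewrite (bigD1 None) //= (bigD1 (Some false)) //=.
by rewrite (bigD1 (Some true)) //= big1 ?addn0 // => -[[]|].
Qed.
(** Each pair contributes one inner vertex, and its third vertex if that is isolated or stands for
    an element of [P]. The summand [#|V|] avoids a subtraction. *)
Lemma sum_pairs (P : pred V) :
  \sum_u \sum_v (1 + ((u != v) || P u : nat)) + #|V| = 2 * (#|V| * #|V|) + #|P|.
Proof.
have row (u : V) : \sum_(v : V) (1 + ((u != v) || P u : nat)) + 1 = 2 * #|V| + P u.
  have sum1V : \sum_(v : V) 1 = #|V| by rewrite sum1_card.
  rewrite big_split /= sum1V [X in _ + X + _](bigD1 u) //= eqxx /=.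
  have -> : \sum_(v | v != u) ((u != v) || P u : nat) = \sum_(v | v != u) 1.
    by apply: eq_bigr => v; rewrite eq_sym => ->.
  have V0 : 0 < #|V| by apply/card_gt0P; exists u.
  rewrite sum1_card cardC1; set N := #|V| in V0 *; lia.
have -> : #|P| = \sum_u P u by rewrite -sum1_card big_mkcond.
rewrite -[X in _ + X = _]sum1_card -big_split /= (eq_bigr _ (fun u _ => row u)).
by rewrite big_split /= sum_nat_const mulnCA.
Qed.

Lemma card_counted : #|counted| + #|V| = 2 * (#|V| * #|V|) + #|sel|.
Proof.
rewrite -sum_pairs card_gvertex; congr (_ + _).
by apply: eq_bigr => u _; apply: eq_bigr => v _; rewrite addnC.
Qed.

Lemma gadget_alpha :
  #|counted| <= alpha gadget <->
  exists S : {set V}, #|sel| <= #|S| /\ {in S &, forall u v, ~~ R u v}.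
Proof.
rewrite -alphaP; split=> [[I indI leI]|[S [leS indS]]]; last first.
  (* For a pair [(u, v)], the inner vertex next to [v] is taken if [u] is in [S], since [R u v] then
     keeps [v] out of [S], and the one next to [u] otherwise. *)
  pose P : pred gvertex := fun s =>
    if s.2 is Some b then b == (s.1.1 \in S) else (s.1.1 != s.1.2) || (s.1.1 \in S).
  have garcP s t : s \in [set s | P s] -> t \in [set s | P s] -> ~~ garc s t.
    case: s t => [[u v] o] [[u' v'] o']; rewrite !inE /P /garc /=.
    case: o o' => [[]|] [[]|] //=.
    - move=> /eqP uS; case: eqP => _; rewrite ?andbF //= => vS.
      by apply/negP => /andP[Ruv /eqP uv]; move: (indS u v); rewrite -uS Ruv -uv vS => /(_ isT isT).
    - by move=> /eqP uS /eqP vS; apply/negP => /andP[/eqP E _]; rewrite -E -uS in vS.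
    - move=> /eqP uS; case: eqP => _; rewrite ?andbF //= => vS.
      by apply/negP => /andP[_ /eqP E]; rewrite E -uS in vS.
  exists [set s | P s].
    apply/forall_inP => s sP; apply/forall_inP => t tP.
    by rewrite /= /gadj negb_or !garcP.
  have : #|[set s | P s]| + #|V| = 2 * (#|V| * #|V|) + #|S|.
    rewrite -(sum_pairs (mem S)) cardsE card_gvertex; congr (_ + _).
    apply: eq_bigr => u _; apply: eq_bigr => v _.
    by rewrite /P /= addnC; congr (_ + _); case: (u \in S).
  by move=> E; rewrite -(leq_add2r #|V|) card_counted E leq_add2l.
pose S0 := [set u | (u, u, None) \in I].
pose viol u v := [&& R u v, u \in S0 & v \in S0].
pose S := [set u in S0 | [forall v, ~~ viol u v]].
exists S; split; last first.
  move=> u v; rewrite !inE => /andP[uS /forallP/(_ v)] + /andP[vS _].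
  by rewrite /viol !inE uS vS !andbT.
have nadj s t : s \in I -> t \in I -> ~~ gadj s t.
  by move=> sI tI; have /forall_inP/(_ _ sI)/forall_inP/(_ _ tI) := indI.
(* A pair has at most one inner vertex in [I], and none if it is a conflict inside [S0]. *)
have pair_le u v : ((u, v, None) \in I) + (((u, v, Some false) \in I) + ((u, v, Some true) \in I))
    + viol u v <= 1 + ((u != v) || (u \in S0)).
  have : ((u, v, None) \in I) <= ((u != v) || (u \in S0)).
    by case: (eqVneq u v) => [->|//]; rewrite inE /=; case: (_ \in I).
  have ft : ~~ (((u, v, Some false) \in I) && ((u, v, Some true) \in I)).
    by apply/negP => /andP[i1 i2]; have := nadj _ _ i1 i2; rewrite /gadj /garc /= !eqxx.
  have : viol u v -> ((u, v, Some false) \notin I) && ((u, v, Some true) \notin I).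
    rewrite /viol !inE => /and3P[Ruv uI vI]; apply/andP; split; apply/negP => i1.
      by have := nadj _ _ i1 uI; rewrite /gadj /garc /= Ruv !eqxx.
    by have := nadj _ _ i1 vI; rewrite /gadj /garc /= Ruv !eqxx.
  by move: ft; case: (viol u v); case: (_ \in I); case: (_ \in I);
    case: (_ \in I) => //= _ /(_ isT).
(* S drops a vertex of S0 for some conflict that it is in, and each conflict
   inside S0 excludes both inner vertices of its path from I. *)
have viol_ge : #|S0 :\: S| <= \sum_u \sum_v (viol u v : nat).
  rewrite -sum1_card big_mkcond /=; apply: leq_sum => u _.
  case: ifP => //; rewrite !inE => /andP[+ uS]; rewrite uS /= => /forallPn[v].
  by rewrite negbK (bigD1 v) //= => ->.
have leI2 : #|I| + #|S0 :\: S| + #|V| <= 2 * (#|V| * #|V|) + #|S0|.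
  rewrite -(sum_pairs (mem S0)) leq_add2r card_gvertex.
  apply: leq_trans (leq_add (leqnn _) viol_ge) _.
  rewrite -big_split; apply: leq_sum => u _; rewrite -big_split.
  by apply: leq_sum => v _; apply: pair_le.
have SS0 : S \subset S0 by apply/subsetP => u; rewrite inE => /andP[].
move: leI leI2 card_counted (cardsD S0 S) (subset_leq_card SS0).
rewrite (setIidPr SS0); set a := #|counted|; set b := #|V|; set c := #|sel|.
set d := #|I|; set e := #|S0|; set g := #|S|; set h := #|_ :\: _|; lia.
Qed.
End Counting.
End Gadget.

(** * Structured programs for multi-tape machines *)

Definition bits (A : finType) (w : seq bool) (i : nat) : sym A :=
  nth None [seq Some (inl b) | b <- w] i.

(* A tape up to trailing blanks: the contents of the cells to the left of the
   head, nearest first, and those from the scanned cell on to the right. *)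
Definition view (A : finType) : Type := ((nat -> sym A) * (nat -> sym A))%type.

Definition view_of A (t : tape A) : view A :=
  (fun i => nth None (tleft t) i, fun i => nth None (tright t) i).

Definition vstep A (v : view A) (s : sym A) (d : move) : view A :=
  match d with
  | MoveL => (fun i => v.1 i.+1,
              fun i => if i is j.+1 then (if j is 0 then s else v.2 j) else v.1 0)
  | MoveR => (fun i => if i is j.+1 then v.1 j else s, fun i => v.2 i.+1)
  | Stay => (v.1, fun i => if i is 0 then s else v.2 i)
  end.

Lemma view_of_step A (t : tape A) s d :
  view_of (tmove (twrite t s) d) = vstep (view_of t) s d.
Proof.
case: t => l r; case: d; rewrite /view_of /vstep /=.
- congr (_, _); apply/funext => i; rewrite ?nth_behead //.
  by case: i => [|[|i]] //=; rewrite ?nth0 ?nth_behead.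
- congr (_, _); apply/funext => i; rewrite ?nth_behead //.
  by case: i => //=; rewrite -nth0.
- congr (_, _); apply/funext => -[|i] //=.
  by rewrite nth_behead.
Qed.

Lemma tread_view A (t : tape A) : tread t = (view_of t).2 0.
Proof. by rewrite /tread /= nth0. Qed.

Lemma vstep_id A (v : view A) : vstep v (v.2 0) Stay = v.
Proof. by case: v => l r; congr (_, _); apply/funext => -[]. Qed.

Lemma view_of_load A w : view_of (tload A w) = (fun=> None, bits A w).
Proof. by congr (_, _); apply/funext => i; rewrite /= nth_nil. Qed.

Lemma bit_prefix_eq A (s : seq (sym A)) w :
  (forall i, nth None s i = bits A w i) -> bit_prefix s = w.
Proof.
elim: s w => [|a s IHs] [|b w] //= E.
- by have := E 0.
- by have := E 0; rewrite /bits /= => ->.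
- by have := E 0; rewrite /bits /= => ->; rewrite (IHs w) // => i; apply: (E i.+1).
Qed.

Section Programs.
Variables (m : nat) (A : finType).

Definition reads : Type := {ffun 'I_m.+1 -> sym A}.
Definition action : Type := 'I_m.+1 -> sym A * move.
Definition store : Type := 'I_m.+1 -> view A.

Inductive prog : Type :=
| Act of (reads -> action)
| Seq of prog & prog
| If of (reads -> bool) & prog & prog
| While of (reads -> bool) & prog.

Definition keep (r : reads) : action := fun i => (r i, Stay).
Definition Skip := Act keep.

Fixpoint pstate (p : prog) : finType :=
  match p with
  | Act _ => unit
  | Seq p q => (pstate p + pstate q)%type
  | If _ p q => option (pstate p + pstate q)%type
  | While _ p => option (pstate p)
  end.

Fixpoint pstart (p : prog) : pstate p :=
  match p return pstate p with
  | Act _ => tt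
  | Seq p q => inl (pstart p)
  | If _ p q => None
  | While _ p => None
  end.

(** The next state [None] signals that the program ends with this step; a sequence then passes to
    its second part without spending a step of its own. The extra states of [If] and [While] only
    evaluate the guard. *)
Fixpoint pnext (p : prog) : pstate p -> reads -> option (pstate p) * action :=
  match p return pstate p -> reads -> option (pstate p) * action with
  | Act a => fun _ r => (None, a r)
  | Seq p q => fun s r =>
      match s with
      | inl s => ((if (pnext s r).1 is Some s' then Some (inl s')
                   else Some (inr (pstart q))), (pnext s r).2)
      | inr s => (omap inr (pnext s r).1, (pnext s r).2)
      end
  | If b p q => fun s r =>
      match s with
      | None => (Some (Some (if b r then inl (pstart p) else inr (pstart q))), keep r)
      | Some (inl s) => (omap (Some \o inl) (pnext s r).1, (pnext s r).2)
      | Some (inr s) => (omap (Some \o inr) (pnext s r).1, (pnext s r).2)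
      end
  | While b p => fun s r =>
      match s with
      | None => (if b r then Some (Some (pstart p)) else None, keep r)
      | Some s => (Some (pnext s r).1, (pnext s r).2)
      end
  end.

Definition vreads (v : store) : reads := [ffun i => (v i).2 0].
Definition vact (v : store) (a : action) : store :=
  fun i => vstep (v i) (a i).1 (a i).2.

Lemma vact_keep v : vact v (keep (vreads v)) = v.
Proof. by apply/funext => i; rewrite /vact /keep ffunE; apply: vstep_id. Qed.

Inductive reach (p : prog) : pstate p -> store -> store -> nat -> Prop :=
| reach_last s v : (pnext s (vreads v)).1 = None ->
    reach s v (vact v (pnext s (vreads v)).2) 1
| reach_next s s' v v' t : (pnext s (vreads v)).1 = Some s' ->
    reach s' (vact v (pnext s (vreads v)).2) v' t -> reach s v v' t.+1.

Definition exec (p : prog) (v v' : store) (T : nat) : Prop :=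
  exists2 t, t <= T & reach (pstart p) v v' t.

Lemma exec_le p v v' T T' : T <= T' -> exec p v v' T -> exec p v v' T'.
Proof. by move=> leT [t let_ r]; exists t => //; apply: leq_trans leT. Qed.

Lemma exec_act a v : exec (Act a) v (vact v (a (vreads v))) 1.
Proof. by exists 1 => //; apply: (@reach_last (Act a)). Qed.

Lemma exec_skip v : exec Skip v v 1.
Proof. by have := exec_act keep v; rewrite vact_keep. Qed.

Lemma reach_seqr p q s v v' t :
  @reach q s v v' t -> @reach (Seq p q) (inr s) v v' t.
Proof.
elim=> {s v v' t} [s v E | s s' v v' t E _ IH].
  by apply: (@reach_last (Seq p q) (inr s)); rewrite /= E.
by apply: (@reach_next (Seq p q) (inr s) (inr s')) => //=; rewrite E.
Qed.

Lemma reach_seql p q s v v1 v' t t' :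
  @reach p s v v1 t -> @reach q (pstart q) v1 v' t' ->
  @reach (Seq p q) (inl s) v v' (t + t').
Proof.
elim=> {s v v1 t} [s v E | s s' v v1 t E _ IH] r.
  apply: (@reach_next (Seq p q) (inl s) (inr (pstart q))); first by rewrite /= E.
  exact: reach_seqr.
apply: (@reach_next (Seq p q) (inl s) (inl s')); first by rewrite /= E.
exact: IH.
Qed.

Lemma exec_seq p q v v1 v' T T' :
  exec p v v1 T -> exec q v1 v' T' -> exec (Seq p q) v v' (T + T').
Proof.
move=> [t leT r] [t' leT' r']; exists (t + t'); first exact: leq_add.
exact: reach_seql r r'.
Qed.

Lemma exec_if b p q v v' T :
  exec (if b (vreads v) then p else q) v v' T -> exec (If b p q) v v' T.+1.
Proof.
case=> t leT r; exists t.+1 => //.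
apply: (@reach_next (If b p q) None
  (Some (if b (vreads v) then inl (pstart p) else inr (pstart q)))) => //=.
rewrite vact_keep; case: (b _) r => r.
  elim: r => {v v' t leT} [s v E | s s' v v' t E _ IH].
    by apply: (@reach_last (If b p q) (Some (inl s))); rewrite /= E.
  by apply: (@reach_next (If b p q) (Some (inl s)) (Some (inl s'))) => //=; rewrite E.
elim: r => {v v' t leT} [s v E | s s' v v' t E _ IH].
  by apply: (@reach_last (If b p q) (Some (inr s))); rewrite /= E.
by apply: (@reach_next (If b p q) (Some (inr s)) (Some (inr s'))) => //=; rewrite E.
Qed.

Lemma exec_while_stop b p v : ~~ b (vreads v) -> exec (While b p) v v 1.
Proof.
move=> nb; exists 1 => //; rewrite -{2}[v]vact_keep.
by apply: (@reach_last (While b p) None); rewrite /= (negPf nb).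
Qed.

Lemma exec_while_next (b : reads -> bool) p v v1 v' T T' : b (vreads v) ->
  exec p v v1 T -> exec (While b p) v1 v' T' ->
  exec (While b p) v v' (T + T').+1.
Proof.
move=> bv [t leT r] [t' leT' r']; exists (t + t').+1.
  by rewrite ltnS leq_add.
apply: (@reach_next (While b p) None (Some (pstart p))); first by rewrite /= bv.
rewrite /= vact_keep; elim: r r' => {v v1 t leT bv} [s v E | s s' v v1 t E _ IH] r'.
  by apply: (@reach_next (While b p) (Some s) None); rewrite /= ?E.
apply: (@reach_next (While b p) (Some s) (Some s')); first by rewrite /= E.
exact: IH.
Qed.

(** [S i] is the store before round [i]. Each round spends one step on the guard, and so does the
    final failing test. *)
Lemma exec_while (S : nat -> store) (b : reads -> bool) p n T :
  (forall i, i < n -> b (vreads (S i)) /\ exec p (S i) (S i.+1) T) ->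
  ~~ b (vreads (S n)) -> exec (While b p) (S 0) (S n) (n * T.+1).+1.
Proof.
elim: n S => [|n IHn] S H nb; first exact: exec_while_stop.
have [b0 e0] := H 0 isT.
have eS := IHn (S \o succn) (fun i lin => H i.+1 lin) nb.
by apply: exec_le (exec_while_next b0 e0 eS); lia.
Qed.

Definition machine_of (p : prog) : machine :=
  @Machine m A (option (pstate p)) (Some (pstart p)) (fun s => s == None)
    (fun s r => if s is Some s then pnext s r else (None, keep r)).

Definition tapes_view p (c : config (machine_of p)) : store :=
  fun i => view_of (ctape c i).

Lemma iter_step_halted (M : machine) (c : config M) t :
  halting (cstate c) -> iter t (@step M) c = c.
Proof. by move=> hc; elim: t => //= t ->; rewrite /step hc. Qed.

Lemma iter_step_le (M : machine) (c : config M) t t' :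
  t <= t' -> halting (cstate (iter t (@step M) c)) ->
  iter t' (@step M) c = iter t (@step M) c.
Proof. by move=> /subnK <- h; rewrite iterD iter_step_halted. Qed.

Lemma machine_of_reach p s (v v' : store) t (c : config (machine_of p)) :
  @reach p s v v' t -> cstate c = Some s -> @tapes_view p c = v ->
  cstate (iter t (@step _) c) = None /\ tapes_view (iter t (@step _) c) = v'.
Proof.
have stepE (c0 : config (machine_of p)) s0 : cstate c0 = Some s0 ->
    cstate (step c0) = (pnext s0 (vreads (tapes_view c0))).1 /\
    tapes_view (step c0) = vact (tapes_view c0) (pnext s0 (vreads (tapes_view c0))).2.
  rewrite /step => ->; rewrite [halting _]/=.
  have -> : [ffun i => tread (ctape c0 i)] = vreads (tapes_view c0).
    by apply/ffunP => i; rewrite !ffunE tread_view.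
  rewrite /=; case: (pnext _ _) => q a /=; split=> //.
  by apply/funext => i; rewrite /tapes_view /vact /= view_of_step.
move=> r; elim: r c => {s v v' t} [s v E | s s' v v' t E r IH] c cs cv.
  by have [] := stepE c s cs; rewrite /= cv E.
have [] := stepE c s cs; rewrite cv E => cs' cv'.
by rewrite iterSr; apply: IH.
Qed.

(** A halted configuration no longer changes, so upper bounds on running times suffice. *)
Lemma machine_of_halts p ws v' w T t :
  exec p (fun i => (fun=> None, bits A (nth [::] ws i))) v' T ->
  (forall i, (v' ord_max).2 i = bits A w i) -> T <= t ->
  halts_in (machine_of p) t ws w.
Proof.
move=> [t0 le0 r] out leT.
have [|c0 cv] := machine_of_reach (c := initial _ ws) r erefl.
  by apply/funext => i; rewrite /tapes_view /= view_of_load.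
have let_ : t0 <= t by apply: leq_trans leT.
have h0 : halting (cstate (iter t0 (@step (machine_of p)) (initial _ ws))).
  by rewrite c0.
split; rewrite (iter_step_le let_ h0) //.
by apply: bit_prefix_eq => i; rewrite -out -cv.
Qed.
End Programs.

(** * Registers as head positions *)

Definition mark : sym unit := Some (inr tt).

Definition word_view (w : seq bool) (p : nat) : view unit :=
  (fun i => if i < p then bits unit w (p - i.+1) else None,
   fun i => bits unit w (p + i)).

(** The head is at cell [v] of a tape that is blank except for the mark in cell 0, so it scans the
    mark exactly when [v = 0]. *)
Definition count_view (v : nat) : view unit :=
  (fun i => if i.+1 == v then mark else None,
   fun i => if (v == 0) && (i == 0) then mark else None).

Definition regs : Type := nat -> nat.

Definition upd (e : regs) (r v : nat) : regs := fun i => if i == r then v else e i.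

Lemma bits_default A w i : size w <= i -> bits A w i = None.
Proof. by move=> le; rewrite /bits nth_default // size_map. Qed.

Lemma bits_nth A w i : i < size w -> bits A w i = Some (inl (nth false w i)).
Proof. by move=> lt; rewrite /bits (nth_map false). Qed.

Lemma word_view_inc w p : vstep (word_view w p) (bits unit w p) MoveR = word_view w p.+1.
Proof.
congr (_, _); apply/funext => i /=; last by congr bits; lia.
case: i => [|i]; first by rewrite subn1.
by rewrite ?ltnS ?subSS.
Qed.

Lemma word_view_dec w p : vstep (word_view w p.+1) (bits unit w p.+1) MoveL = word_view w p.
Proof.
congr (_, _); apply/funext => i /=.
case: i => [|[|i]]; [by congr bits; lia | by congr bits; lia |].
by congr bits; lia.
Qed.

Lemma word_view_emit w b :
  vstep (word_view w (size w)) (Some (inl b)) MoveR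
  = word_view (rcons w b) (size (rcons w b)).
Proof.
rewrite size_rcons; congr (_, _); apply/funext => i /=.
  case: i => [|i]; first by rewrite bits_nth ?size_rcons ?nth_rcons subn1 ?ltnn ?eqxx.
  rewrite ltnS subSS; case: ifP => // lt.
  rewrite !bits_nth ?size_rcons; [|lia|lia].
  by rewrite nth_rcons; case: ifP => //; lia.
by rewrite !bits_default // ?size_rcons; lia.
Qed.

Lemma count_view_inc v :
  vstep (count_view v) ((count_view v).2 0) MoveR = count_view v.+1.
Proof.
congr (_, _); apply/funext => i /=; last by rewrite andbF.
by case: i => [|i]; rewrite ?andbT // eqSS; case: v.
Qed.

Lemma count_view_dec v :
  vstep (count_view v.+1) ((count_view v.+1).2 0) MoveL = count_view v.
Proof.
congr (_, _); apply/funext => i //=.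
by case: i => [|[|i]] //=; rewrite ?andbF // andbT eqSS eq_sym.
Qed.

Section Registers.
Variable m : nat.
Hypothesis m_gt0 : 0 < m.

(* Register 0 is the position of the head on the input tape, the registers
   strictly between 0 and m are the head positions on tapes whose cell 0 is
   marked, and tape m receives the output. *)
Definition st (x : seq bool) (e : regs) (out : seq bool) : store m unit :=
  fun i => if i == 0 :> nat then word_view x (e 0)
           else if i == m :> nat then word_view out (size out)
           else count_view (e i).

Definition shift_act (r : nat) (d : move) (rd : reads m unit) : action m unit :=
  fun i => (rd i, if i == r :> nat then d else Stay).
Definition Shift (r : nat) (d : move) := Act (shift_act r d).
Definition Inc r := Shift r MoveR.
Definition Dec r := Shift r MoveL.
Definition emit_act (b : bool) (rd : reads m unit) : action m unit :=
  fun i => if i == m :> nat then (Some (inl b), MoveR) else (rd i, Stay).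
Definition Emit (b : bool) := Act (emit_act b).

Definition pos (r : nat) (rd : reads m unit) : bool := rd (inord r) != mark.

Lemma exec_shift x e out r d v :
  r < m ->
  (forall w, vstep (word_view w (e r)) (bits unit w (e r)) d = word_view w v) ->
  vstep (count_view (e r)) ((count_view (e r)).2 0) d = count_view v ->
  exec (Shift r d) (st x e out) (st x (upd e r v) out) 1.
Proof.
move=> ltr H0 H1.
have -> : st x (upd e r v) out =
  vact (st x e out) (shift_act r d (vreads (st x e out))).
  apply/funext => i; symmetry; rewrite /vact /shift_act /vreads ffunE /st /upd.
  case: (eqVneq (i : nat) 0) => [i0|i0].
    rewrite i0; case: (eqVneq 0 r) => [r0|_]; last exact: vstep_id.
    by rewrite -r0 in H0; rewrite [_.2 0]/= addn0 H0.
  case: (eqVneq (i : nat) m) => [im|im].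
    rewrite ifF; [exact: vstep_id | rewrite im; exact: gtn_eqF].
  case: (eqVneq (i : nat) r) => [->|_]; first by rewrite H1.
  exact: vstep_id.
exact: exec_act.
Qed.

Lemma exec_inc x e out r : r < m ->
  exec (Inc r) (st x e out) (st x (upd e r (e r).+1) out) 1.
Proof.
move=> ltr; apply: exec_shift => // [w|]; first exact: word_view_inc.
exact: count_view_inc.
Qed.

Lemma exec_dec x e out r : r < m -> 0 < e r ->
  exec (Dec r) (st x e out) (st x (upd e r (e r).-1) out) 1.
Proof.
move=> ltr e0; apply: exec_shift => // [w|]; rewrite -(prednK e0).
  exact: word_view_dec.
exact: count_view_dec.
Qed.

Lemma exec_emit x e out b :
  exec (Emit b) (st x e out) (st x e (rcons out b)) 1.
Proof.
have -> : st x e (rcons out b) =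
  vact (st x e out) (emit_act b (vreads (st x e out))).
  apply/funext => i; symmetry; rewrite /vact /emit_act /vreads /st.
  case: (eqVneq (i : nat) 0) => [i0|i0].
    by rewrite i0 (ltn_eqF m_gt0) ffunE i0; apply: vstep_id.
  case: (eqVneq (i : nat) m) => [im|im]; first by rewrite word_view_emit.
  by rewrite ffunE (negPf i0) (negPf im); apply: vstep_id.
exact: exec_act.
Qed.

Lemma posE x e out r : 0 < r < m -> pos r (vreads (st x e out)) = (0 < e r).
Proof.
case/andP=> r0 rm; rewrite /pos ffunE /st inordK; last by lia.
rewrite gtn_eqF // ltn_eqF //= andbT.
by case: (e r).
Qed.

Lemma reads0 x e out : vreads (st x e out) ord0 = bits unit x (e 0).
Proof. by rewrite ffunE /st /= addn0. Qed.
End Registers.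

(** * Transferring and comparing registers *)

Section Macros.
Variables (m : nat) (x : seq bool).
Hypothesis m_gt0 : 0 < m.
Implicit Types (e : regs) (out : seq bool).

Notation stx := (@st m x).

Lemma st_ext e e' out : e =1 e' -> stx e out = stx e' out.
Proof. by move=> /funext ->. Qed.

Lemma exec_to (p : prog m unit) v v1 v2 T :
  exec p v v1 T -> v1 = v2 -> exec p v v2 T.
Proof. by move=> ? <-. Qed.

Definition Incs (us : seq nat) : prog m unit := foldr (fun r => Seq (Inc m r)) (Skip m unit) us.
Definition Decs (ds : seq nat) : prog m unit := foldr (fun r => Seq (Dec m r)) (Skip m unit) ds.

Definition transfer e (us ds : seq nat) (i : nat) : regs :=
  fun r => e r + i * (r \in us) - i * (r \in ds).

Lemma exec_incs e out us : all (ltn^~ m) us -> uniq us ->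
  exec (Incs us) (stx e out) (stx (transfer e us [::] 1) out) (size us).+1.
Proof.
elim: us e => [|r us IH] e /=.
  by move=> _ _; apply: exec_to (exec_skip _) _; apply: st_ext => i; rewrite /transfer !in_nil; lia.
case/andP=> rm am /andP[rus us_uniq].
apply: exec_to; first exact: exec_seq (exec_inc _ _ _ rm) (IH _ am us_uniq).
apply: st_ext => i; rewrite /transfer /upd !inE.
by case: eqP => [->|]; rewrite ?(negPf rus) /=; lia.
Qed.

Lemma exec_decs e out ds : all (ltn^~ m) ds -> uniq ds ->
  (forall r, r \in ds -> 0 < e r) ->
  exec (Decs ds) (stx e out) (stx (transfer e [::] ds 1) out) (size ds).+1.
Proof.
elim: ds e => [|r ds IH] e /=.
  by move=> _ _ _; apply: exec_to (exec_skip _) _; apply: st_ext => i; rewrite /transfer !in_nil; lia.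
case/andP=> rm am /andP[rds ds_uniq] epos.
apply: exec_to.
  apply: exec_seq (exec_dec _ _ rm _) (IH _ am ds_uniq _) => //.
    by apply: epos; rewrite inE eqxx.
  move=> i ids; rewrite /upd; case: eqP => [ir|_]; first by rewrite -ir ids in rds.
  by apply: epos; rewrite inE ids orbT.
apply: st_ext => i; rewrite /transfer /upd !inE.
by case: eqP => [->|]; rewrite ?(negPf rds) /=; lia.
Qed.

Definition Transfer (g : reads m unit -> bool) (us ds : seq nat) : prog m unit :=
  While g (Seq (Incs us) (Decs ds)).

Lemma exec_transfer g us ds n e out :
  all (ltn^~ m) (us ++ ds) -> uniq (us ++ ds) ->
  (forall r, r \in ds -> n <= e r) ->
  (forall i, i <= n -> g (vreads (stx (transfer e us ds i) out)) = (i < n)) ->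
  exec (Transfer g us ds) (stx e out) (stx (transfer e us ds n) out)
       (n * (size us + size ds + 3)).+1.
Proof.
rewrite all_cat cat_uniq => /andP[um dm] /and3P[uu /hasPn disj du] en gn.
have -> : stx e out = stx (transfer e us ds 0) out.
  by apply: st_ext => i; rewrite /transfer !mul0n addn0 subn0.
apply: exec_le; last apply: (exec_while (S := fun i => stx (transfer e us ds i) out)
   (n := n) (T := ((size us).+1 + (size ds).+1))).
- by lia.
- move=> i ltin; split; first by rewrite gn ?ltin // ltnW.
  apply: exec_to; first apply: exec_seq (exec_incs _ _ um uu) (exec_decs _ dm du _).
    move=> r rds; rewrite /transfer (negPf (disj r rds)) rds.
    by rewrite /= muln0 muln1 addn0; have := en r rds; lia.
  apply: st_ext => r; rewrite /transfer !in_nil /= !mul1n ?addn0 ?subn0.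
  case: (boolP (r \in ds)) => [rds|_]; last by rewrite !muln0; case: (r \in us); lia.
  by rewrite (negPf (disj r rds)) /= !muln0 !muln1; have := en r rds; lia.
- by rewrite gn // ltnn.
Qed.

(** Adds the value of [r] to the registers in [us], subtracts it from those in [ds] and leaves [r]
    at 0. Moving to two registers and moving one of them back makes a copy; empty lists clear
    [r]. *)
Definition Move (r : nat) (us ds : seq nat) := Transfer (pos r) us (r :: ds).

Lemma exec_move r us ds e out :
  all (ltn^~ m) (us ++ r :: ds) -> uniq (us ++ r :: ds) -> 0 < r ->
  (forall s, s \in ds -> e r <= e s) ->
  exec (Move r us ds) (stx e out) (stx (transfer e us (r :: ds) (e r)) out)
       (e r * (size us + size ds + 4)).+1.
Proof.
move=> am un r0 er.
have rm : r < m by apply: (allP am); rewrite mem_cat inE eqxx orbT.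
have rus : r \notin us.
  by move: un; rewrite cat_uniq /= => /and3P[_ /norP[]].
apply: exec_le; last apply: exec_transfer am un _ _; first by rewrite /=; lia.
- by move=> s; rewrite inE => /orP[/eqP->|] //; apply: er.
- move=> i le_i; rewrite (posE m_gt0) ?r0 //.
  by rewrite /transfer (negPf rus) inE eqxx /=; lia.
Qed.

(* Once a and b have been lowered together until one of them is 0, the order of
   their original values is visible from which of them is 0. *)
Definition Cmp (a b c : nat) (k : bool -> bool -> prog m unit) : prog m unit :=
  let restore := Move c [:: a; b] [::] in
  Seq (Transfer (fun rd => pos a rd && pos b rd) [:: c] [:: a; b])
      (If (pos a) (Seq restore (k false true))
         (If (pos b) (Seq restore (k true false)) (Seq restore (k true true)))).

Lemma exec_cmp a b c k e out v T B :
  all (fun r => 0 < r < m) [:: a; b; c] -> uniq [:: a; b; c] -> e c = 0 ->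
  e a <= B ->
  exec (k (e a <= e b) (e b <= e a)) (stx e out) v T ->
  exec (Cmp a b c k) (stx e out) v (T + 12 * B + 4).
Proof.
rewrite /= !inE !andbT => /and3P[am bm cm] /andP[/norP[ab ac] bc] ec aB ek.
(* The number of rounds. It is kept in [c], so moving [c] to [a] and [b] undoes the lowering. *)
pose n := minn (e a) (e b).
have am' : a < m by lia.
have bm' : b < m by lia.
have cm' : c < m by lia.
have E1 : exec (Transfer (fun rd => pos a rd && pos b rd) [:: c] [:: a; b])
  (stx e out) (stx (transfer e [:: c] [:: a; b] n) out) (n * 6).+1.
  apply: exec_transfer; rewrite /= ?inE ?am' ?bm' ?cm' ?andbT //.
  - by rewrite negb_or eq_sym ac eq_sym bc ab.
  - by move=> r; rewrite !inE => /orP[] /eqP->; rewrite /n; lia.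
  - move=> i le_in; rewrite !(posE m_gt0) // /transfer !inE !eqxx (negPf ac) (negPf bc) orbT /=.
    by move: le_in; rewrite /n; lia.
have E2 : exec (Move c [:: a; b] [::]) (stx (transfer e [:: c] [:: a; b] n) out)
    (stx e out) (n * 6).+1.
  have trc : transfer e [:: c] [:: a; b] n c = n.
    by rewrite /transfer !inE eqxx eq_sym (negPf ac) eq_sym (negPf bc) /= ec; lia.
  apply: (@exec_le _ _ _ _ _ (transfer e [:: c] [:: a; b] n c * 6).+1).
    by rewrite trc.
  apply: exec_to.
    by apply: exec_move; rewrite /= ?inE ?am' ?bm' ?cm' ?andbT ?(negPf ab) ?(negPf ac) ?(negPf bc) //; lia.
  apply: st_ext => r; rewrite trc /transfer !inE.
  case: (eqVneq r a) => [->|ra]; first by rewrite (negPf ab) (negPf ac) /= /n; lia.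
  case: (eqVneq r b) => [->|rb]; first by rewrite (negPf bc) /= /n; lia.
  by case: (eqVneq r c) => [->|rc] /=; rewrite ?ec; lia.
have nB : n <= B by rewrite /n; lia.
have K k0 T0 : exec k0 (stx e out) v T0 ->
    exec (Seq (Move c [:: a; b] [::]) k0) (stx (transfer e [:: c] [:: a; b] n) out) v (T0 + 6 * B + 1).
  by move=> e0; apply: exec_le (exec_seq E2 e0); lia.
apply: (@exec_le _ _ _ _ _ ((n * 6).+1 + (T + 6 * B + 1).+2)); first by lia.
apply: exec_seq E1 _; apply: exec_if.
rewrite (posE m_gt0) // /transfer !inE eqxx (negPf ac) /= muln0 muln1 addn0.
have -> : (0 < e a - n) = ~~ (e a <= e b) by rewrite /n; lia.
case: (boolP (e a <= e b)) ek => ab' ek /=; last first.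
  have ba : e b <= e a by lia.
  by rewrite ba in ek; apply: exec_le (K _ _ ek); lia.
apply: exec_if; rewrite (posE m_gt0) // !inE eqxx (negPf bc) orbT /= muln0 muln1 addn0.
have -> : (0 < e b - n) = ~~ (e b <= e a) by rewrite /n; lia.
by case: (e b <= e a) ek => ek /=; apply: K.
Qed.
End Macros.

(** Register 0 is the input head; 1 to 3 hold the input length and two polynomial values; 4 and 5
    are scratch; 7 stays 0; 8 to 23 serve eight nested loops, two registers each. Tape 24 is the
    output tape. *)
Definition nregs := 24.
Notation rprog := (prog nregs unit).
Notation rst := (@st nregs).

(** The input head, at rest on position 0, is driven to the position in [z] while [c] keeps the
    value of [z]. The outcome is held in the control state, hence a copy of the restoring code in
    each branch. *)
Definition BitTest (b : bool) (z c : nat) (k : bool -> rprog) : rprog :=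
  let restore := Move nregs c [:: z] [:: 0] in
  Seq (Move nregs z [:: c; 0] [::])
      (If (fun rd => rd ord0 == Some (inl b)) (Seq restore (k true)) (Seq restore (k false))).

Lemma exec_bit_test x b z c k e out v T B :
  all (fun r => 0 < r < nregs) [:: z; c] -> z != c -> e c = 0 -> e 0 = 0 -> e z <= B ->
  exec (k (bits unit x (e z) == Some (inl b))) (rst x e out) v T ->
  exec (BitTest b z c k) (rst x e out) v (T + 12 * B + 4).
Proof.
rewrite /= andbT => /andP[zm cm] zc ec e0 zB ek.
have zm' : z < nregs by lia.
have cm' : c < nregs by lia.
have [cz z0 c0] : [/\ c == z = false, z == 0 = false & c == 0 = false] by split; lia.
have [zc' z0' c0'] : [/\ z == c = false, 0 == z = false & 0 == c = false] by split; lia.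
pose e1 := transfer e [:: c; 0] [:: z] (e z).
have E1 : exec (Move nregs z [:: c; 0] [::]) (rst x e out) (rst x e1 out) (e z * 6).+1.
  apply: exec_le; last apply: exec_move;
  by rewrite /= ?inE ?zm' ?cm' ?cz ?c0 ?z0' //; lia.
have e1c : e1 c = e z by rewrite /e1 /transfer !inE eqxx cz /= ec; lia.
have e10 : e1 0 = e z by rewrite /e1 /transfer !inE eqxx orbT z0' /= e0; lia.
have E2 : exec (Move nregs c [:: z] [:: 0]) (rst x e1 out) (rst x e out) (e z * 6).+1.
  apply: (@exec_le _ _ _ _ _ (e1 c * 6).+1); first by rewrite e1c.
  apply: exec_to.
    apply: exec_move; rewrite /= ?inE ?zm' ?cm' ?zc' ?c0 ?z0 //; first by lia.
    by move=> s; rewrite inE => /eqP->; rewrite e1c e10.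
  apply: st_ext => r; rewrite e1c /e1 /transfer !inE.
  case: (eqVneq r z) => [->|rz]; first by rewrite z0 zc' /=; lia.
  case: (eqVneq r 0) => [->|r0]; first by rewrite c0' /= e0; lia.
  by case: (eqVneq r c) => [->|rc] /=; rewrite ?ec; lia.
apply: (@exec_le _ _ _ _ _ ((e z * 6).+1 + ((e z * 6).+1 + T).+1)); first by lia.
apply: exec_seq E1 _; apply: exec_if; rewrite reads0 e10.
by case: (_ == _) ek => ek; apply: exec_seq E2 ek.
Qed.

(* A test (kind, a, b): kind 0 is "a <= b", kind 1 is "a + 1 = b" and kind 2 is
   "the input bit at position a is (b == 1)". *)
Definition test : Type := (nat * nat * nat)%type.

Definition holds (x : seq bool) (e : regs) (t : test) : bool :=
  let: (k, a, b) := t in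
  if k == 0 then e a <= e b else
  if k == 1 then (e a).+1 == e b else bits unit x (e a) == Some (inl (b == 1)).

Definition Test (t : test) (k : bool -> rprog) : rprog :=
  let: (i, a, b) := t in
  if i == 0 then Cmp a b 4 (fun p _ => k p) else
  if i == 1 then
    Seq (Inc nregs a) (Cmp a b 4 (fun p q => Seq (Dec nregs a) (k (p && q))))
  else BitTest (b == 1) a 4 k.

(** A comparison lowers its two registers together, so they have to differ; in a bit test [b] is a
    bit, not a register. *)
Definition valid (rs : seq nat) (t : test) : bool :=
  let: (k, a, b) := t in [&& a \in rs, (k < 2) ==> (b \in rs) & (k < 2) ==> (a != b)].

Section Tests.
Variables (x : seq bool) (e : regs) (out : seq bool) (rs : seq nat) (B : nat).
Hypothesis rs_reg : all (fun r => [&& 0 < r, r < nregs, r != 4 & e r <= B]) rs.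
Hypotheses (e0 : e 0 = 0) (e4 : e 4 = 0).

Lemma exec_test t k v T : valid rs t ->
  exec (k (holds x e t)) (rst x e out) v T ->
  exec (Test t k) (rst x e out) v (T + (12 * B + 18)).
Proof.
case: t => [[i a] b] /and3P[ars brs ab] ek.
have /and4P[a0 am a4 aB] := allP rs_reg _ ars.
rewrite /Test /holds in ek *; case: (posnP i) ek => [i0|i_gt0] ek.
  have ab' : a != b by move: ab; rewrite i0.
  have /and4P[b0 bm b4 _] : [&& 0 < b, b < nregs, b != 4 & e b <= B].
    by apply: (allP rs_reg); move: brs; rewrite i0.
  apply: exec_le; last apply: (exec_cmp _ (B := B) _ _ e4 aB ek) => //=; try lia.
  by rewrite !inE; lia.
case: (eqVneq i 1) ek => [i1|i1] ek.
  have ab' : a != b by move: ab; rewrite i1.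
  have /and4P[b0 bm b4 bB] : [&& 0 < b, b < nregs, b != 4 & e b <= B].
    by apply: (allP rs_reg); move: brs; rewrite i1.
  (* The bound is [B.+1] because [a] is incremented before the comparison. *)
  apply: (@exec_le _ _ _ _ _ (1 + ((1 + T) + 12 * B.+1 + 4))); first by lia.
  apply: exec_seq; first exact: exec_inc.
  have updb : upd e a (e a).+1 b = e b by rewrite /upd ifN // eq_sym.
  have upda : upd e a (e a).+1 a = (e a).+1 by rewrite /upd eqxx.
  apply: exec_cmp => //=; first by lia.
  - by rewrite !inE; lia.
  - by rewrite /upd ifN // eq_sym.
  - by rewrite upda.
  apply: exec_seq; first by apply: exec_dec; rewrite // upda.
  rewrite upda updb -eqn_leq.
  suff -> : rst x (upd (upd e a (e a).+1) a (e a)) out = rst x e out by [].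
  by apply: st_ext => r; rewrite /upd; case: eqP => // ->.
apply: exec_le; last apply: (exec_bit_test _ a4 e4 e0 aB ek) => //=; lia.
Qed.

(* The program k val is copied for each outcome val of the tests, so that the
   outcomes are remembered in the control state. *)
Fixpoint Tests (l : seq test) (val : test -> bool) (k : (test -> bool) -> rprog) :=
  if l is t :: l then Test t (fun b => Tests l (fun s => if s == t then b else val s) k)
  else k val.

Lemma exec_tests l val k v T : all (valid rs) l ->
  exec (k (fun s => if s \in l then holds x e s else val s)) (rst x e out) v T ->
  exec (Tests l val k) (rst x e out) v (T + size l * (12 * B + 18)).
Proof.
elim: l val => [|t l IH] val /=; first by move=> _; apply: exec_le; lia.
case/andP=> vt vl ek; rewrite mulSn addnCA addnA [_ + T]addnC -addnA addnCA addnC.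
apply: exec_test => //; apply: IH => //.
apply: exec_to erefl; move: ek; congr (exec (k _) _ _ _); apply/funext => s.
by rewrite inE; case: (eqVneq s t) => [->|] //=; case: ifP.
Qed.
End Tests.

(** * Loops that emit output *)

Section Loops.
Variables (x : seq bool) (n Q B : nat).

(* The loop variable of depth d lives in register 8 + 2d; the next register
   holds the number of iterations that remain. *)
Definition env (cs : seq nat) : regs := fun r =>
  if r == 1 then n else if r == 2 then Q else if r == 3 then B else
  if r < 8 then 0 else
  if (r - 8)./2 < size cs then
    (if odd r then B - (nth 0 cs (r - 8)./2).+1 else nth 0 cs (r - 8)./2)
  else 0.

(** [cs] lists the values of the enclosing loop variables, outermost first. The bound on the size of
    the output later bounds the time for rewinding the output tape. *)
Definition emits (p : rprog) (d : nat) (o : seq nat -> seq bool) (T : nat) : Prop :=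
  forall cs out, size cs = d -> all (ltn^~ B) cs ->
    size (o cs) <= T /\ exec p (rst x (env cs) out) (rst x (env cs) (out ++ o cs)) T.

Lemma emits_emit b d : emits (Emit nregs b) d (fun=> [:: b]) 1.
Proof. by move=> cs out _ _; split => //; rewrite cats1; apply: exec_emit. Qed.

Lemma emits_skip d : emits (Skip _ _) d (fun=> [::]) 1.
Proof. by move=> cs out _ _; split => //; rewrite cats0; apply: exec_skip. Qed.

Lemma emits_seq p q d o o' T T' : emits p d o T -> emits q d o' T' ->
  emits (Seq p q) d (fun cs => o cs ++ o' cs) (T + T').
Proof.
move=> Hp Hq cs out sz lt.
have [lo Eo] := Hp cs out sz lt; have [lo' Eo'] := Hq cs (out ++ o cs) sz lt.
by rewrite size_cat leq_add // catA; split=> //; apply: exec_seq Eo Eo'.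
Qed.

Definition Each (I : Type) (l : seq I) (p : I -> rprog) : rprog :=
  foldr (fun i => Seq (p i)) (Skip _ _) l.

Lemma emits_each (I : Type) (l : seq I) (p : I -> rprog) d o T :
  (forall i, emits (p i) d (o i) T) ->
  emits (Each l p) d (fun cs => flatten [seq o i cs | i <- l]) (size l * T + 1).
Proof.
move=> H; elim: l => [|i l IH] /=; first exact: emits_skip.
by rewrite mulSn -addnA; apply: emits_seq.
Qed.

(** Register 3 is copied to the countdown by way of register 4. The countdown is lowered before the
    body and the variable raised after it, so that the body of round [i] sees exactly [env] of the
    list extended by [i]. *)
Definition For (d : nat) (p : rprog) : rprog :=
  Seq (Move _ 3 [:: 9 + d.*2; 4] [::])
 (Seq (Move _ 4 [:: 3] [::])
 (Seq (While (pos (9 + d.*2)) (Seq (Dec _ (9 + d.*2)) (Seq p (Inc _ (8 + d.*2)))))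
      (Move _ (8 + d.*2) [::] [::]))).

Lemma env_old cs d i r : size cs = d -> r != 8 + d.*2 -> r != 9 + d.*2 ->
  env (rcons cs i) r = env cs r.
Proof.
move=> sz r8 r9; rewrite /env size_rcons sz.
do 4 case: ifP => // ?.
case: (ltnP (r - 8)./2 d) => lt; last by rewrite ifF //; lia.
by rewrite ifT; [rewrite nth_rcons sz lt | lia].
Qed.

Lemma env_new cs d i : size cs = d ->
  [/\ env (rcons cs i) (8 + d.*2) = i, env (rcons cs i) (9 + d.*2) = B - i.+1,
      env cs (8 + d.*2) = 0 & env cs (9 + d.*2) = 0].
Proof.
move=> sz; rewrite /env size_rcons sz.
have -> : (8 + d.*2 - 8)./2 = d by lia.
have -> : (9 + d.*2 - 8)./2 = d by lia.
by rewrite !nth_rcons sz !ltnn !eqxx ltnSn /= odd_double.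
Qed.

Lemma emits_for p d o T : d < 8 -> emits p d.+1 o T ->
  emits (For d p) d (fun cs => flatten [seq o (rcons cs i) | i <- iota 0 B])
    (B * T + 18 * B + 5).
Proof.
move=> d8 H cs out sz ltB; split.
  have : size (flatten [seq o (rcons cs i) | i <- iota 0 B]) <= B * T.
    rewrite -{2}[B](size_iota 0); have : all (ltn^~ B) (iota 0 B).
      by apply/allP => i; rewrite mem_iota.
    elim: (iota 0 B) => //= i l IH /andP[iB lB].
    rewrite size_cat mulSn leq_add ?IH //.
    have [] := H (rcons cs i) [::]; rewrite ?size_rcons ?sz //.
    by rewrite all_rcons /= iB.
  by lia.
have [m8 m9] : 8 + d.*2 < nregs /\ 9 + d.*2 < nregs by rewrite /nregs; lia.
pose e1 := upd (upd (upd (env cs) 3 0) (9 + d.*2) B) 4 B.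
pose e i := upd (upd (env cs) (9 + d.*2) (B - i)) (8 + d.*2) i.
have [_ _ z8 z9] := env_new 0 sz.
have z4 : env cs 4 = 0 by [].
have z3 : env cs 3 = B by [].
have E1 : exec (Move nregs 3 [:: 9 + d.*2; 4] [::]) (rst x (env cs) out)
            (rst x e1 out) (B * 6).+1.
  apply: exec_to.
    by apply: (@exec_move nregs x isT _ _ _ (env cs)) => //=; rewrite ?inE ?m9 //=; lia.
  apply: st_ext => r; rewrite z3 /e1 /upd /transfer !inE.
  case: (eqVneq r 4) => [->|r4]; first by rewrite z4; lia.
  case: (eqVneq r (9 + d.*2)) => [->|r9]; first by rewrite z9 /=; lia.
  by case: (eqVneq r 3) => [->|r3]; rewrite ?z3 /=; lia.
have e14 : e1 4 = B by rewrite /e1 /upd eqxx.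
have E2 : exec (Move nregs 4 [:: 3] [::]) (rst x e1 out) (rst x (e 0) out) (B * 5).+1.
  apply: (@exec_le _ _ _ _ _ (e1 4 * 5).+1); first by rewrite e14.
  apply: exec_to; first by apply: (@exec_move nregs x isT _ _ _ e1).
  apply: st_ext => r; rewrite e14 /e /e1 /upd /transfer !inE.
  case: (eqVneq r 4) => [->|r4]; first by rewrite /= z4; lia.
  case: (eqVneq r (9 + d.*2)) => [->|r9].
    by rewrite ifF /=; lia.
  case: (eqVneq r 3) => [->|r3]; first by rewrite z3 /=; lia.
  by case: (eqVneq r (8 + d.*2)) => [->|r8]; rewrite ?z8 /=; lia.
pose S i := rst x (e i) (out ++ flatten [seq o (rcons cs j) | j <- iota 0 i]).
have E3 : exec (While (pos (9 + d.*2)) (Seq (Dec _ (9 + d.*2)) (Seq p (Inc _ (8 + d.*2)))))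
   (S 0) (S B) (B * (1 + (T + 1)).+1).+1.
  apply: exec_while => [i iB|]; last first.
    by rewrite posE ?m9 // /e /upd ifF ?eqxx ?subnn //; lia.
  split; first by rewrite posE ?m9 // /e /upd ifF ?eqxx; lia.
  have [n8 n9 _ _] := env_new i sz.
  have dec_e : upd (e i) (9 + d.*2) (e i (9 + d.*2)).-1 = env (rcons cs i).
    apply/funext => r; case: (eqVneq r (9 + d.*2)) => [->|r9].
      by rewrite n9 /upd eqxx /e /upd ifF ?eqxx; lia.
    case: (eqVneq r (8 + d.*2)) => [->|r8].
      by rewrite n8 /upd /e /upd ifF ?eqxx; lia.
    by rewrite (env_old _ sz) // /e /upd (negPf r8) (negPf r9).
  have [||_ Ei] := H (rcons cs i) (out ++ flatten [seq o (rcons cs j) | j <- iota 0 i]).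
  - by rewrite size_rcons sz.
  - by rewrite all_rcons /= iB.
  apply: exec_to.
    apply: exec_seq; first by apply: exec_dec => //; rewrite /e /upd ifF ?eqxx; lia.
    by rewrite dec_e; apply: exec_seq Ei (exec_inc _ _ _ _).
  rewrite /S -(addn1 i) iotaD map_cat flatten_cat /= cats0 catA.
  apply: st_ext => r; rewrite {1}/upd n8; case: (eqVneq r (8 + d.*2)) => [->|r8].
    by rewrite /e /upd eqxx ?addn1.
  case: (eqVneq r (9 + d.*2)) => [->|r9].
    by rewrite n9 /e /upd ifF ?eqxx; lia.
  by rewrite (env_old _ sz) // /e /upd (negPf r8) (negPf r9).
have E4 : exec (Move nregs (8 + d.*2) [::] [::])
    (S B) (rst x (env cs) (out ++ flatten [seq o (rcons cs j) | j <- iota 0 B])) (B * 4).+1.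
  have eB : e B (8 + d.*2) = B by rewrite /e /upd eqxx.
  apply: (@exec_le _ _ _ _ _ (e B (8 + d.*2) * 4).+1); first by rewrite eB.
  apply: exec_to; first by apply: (@exec_move nregs x isT _ _ _ (e B)); rewrite //= m8.
  apply: st_ext => r; rewrite eB /e /upd /transfer !inE.
  case: (eqVneq r (8 + d.*2)) => [->|r8]; first by rewrite z8 /=; lia.
  by case: (eqVneq r (9 + d.*2)) => [->|r9]; rewrite ?z9 /=; lia.
have S0 : S 0 = rst x (e 0) out by rewrite /S /= cats0.
apply: exec_le; last first.
  by apply: exec_seq E1 (exec_seq E2 (exec_seq _ E4)); rewrite -S0; apply: E3.
by lia.
Qed.
End Loops.

(** * Polynomial bounds *)

Definition Add (r c : nat) : rprog := iter c (Seq (Inc nregs r)) (Skip _ _).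

Lemma exec_add x e out r c : r < nregs ->
  exec (Add r c) (rst x e out) (rst x (upd e r (e r + c)) out) c.+1.
Proof.
move=> rm; elim: c e => [|c IH] e /=.
  by apply: exec_to (exec_skip _) _; apply: st_ext => i; rewrite /upd addn0; case: eqP => [->|].
apply: exec_to; first exact: exec_seq (exec_inc _ _ _ rm) (IH _).
by apply: st_ext => i; rewrite /upd eqxx; case: eqP => // _; lia.
Qed.

(** Multiplies [r] by register 1: the old value of [r] counts down in register 4, while register 1
    is repeatedly added to [r] and restored from register 5. *)
Definition Mult (r : nat) : rprog :=
  Seq (Move _ r [:: 4] [::])
      (While (pos 4) (Seq (Dec _ 4) (Seq (Move _ 1 [:: 5; r] [::]) (Move _ 5 [:: 1] [::])))).

Lemma exec_mult x e out r : 1 < r < 4 -> e 4 = 0 -> e 5 = 0 ->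
  exec (Mult r) (rst x e out) (rst x (upd e r (e r * e 1)) out)
    (e r * (11 * e 1 + 10) + 2).
Proof.
move=> hr e4 e5.
have rm : r < nregs by move: hr; rewrite /nregs; lia.
have [r1 r4 r5 r0] : [/\ r == 1 = false, r == 4 = false, r == 5 = false & 0 < r] by split; lia.
have [r1' r4' r5'] : [/\ 1 == r = false, 4 == r = false & 5 == r = false] by split; lia.
pose f i := upd (upd e r (i * e 1)) 4 (e r - i).
have E1 : exec (Move _ r [:: 4] [::]) (rst x e out) (rst x (f 0) out) (e r * 5).+1.
  apply: exec_to; first by apply: (@exec_move nregs x isT); rewrite /= ?inE ?rm ?r4'.
  apply: st_ext => i; rewrite /f /upd /transfer !inE.
  case: (eqVneq i 4) => [->|i4]; first by rewrite r4' e4 /=; lia.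
  by case: (eqVneq i r) => [->|ir] /=; lia.
apply: (@exec_le _ _ _ _ _ ((e r * 5).+1 + (e r * (1 + ((e 1 * 6).+1 + (e 1 * 5).+1)).+1).+1)).
  by nia.
apply: exec_seq E1 _.
have -> : rst x (upd e r (e r * e 1)) out = rst x (f (e r)) out.
  apply: st_ext => i; rewrite /f /upd subnn; case: (eqVneq i 4) => [->|//].
  by rewrite r4' e4.
apply: (exec_while (S := fun i => rst x (f i) out)) => [i ltin|]; last first.
  by rewrite posE // /f /upd eqxx subnn.
have f1 : f i 1 = e 1 by rewrite /f /upd /= r1'.
have f4 : f i 4 = e r - i by rewrite /f /upd eqxx.
split; first by rewrite posE // f4 subn_gt0.
pose g := upd (f i) 4 (e r - i).-1.
pose h := transfer g [:: 5; r] [:: 1] (e 1).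
have g1 : g 1 = e 1 by rewrite /g /upd /= -/(upd _ _ _ _) f1.
have g5 : g 5 = 0 by rewrite /g /f /upd /= r5' e5.
have h5 : h 5 = e 1 by rewrite /h /transfer g5 !inE /=; lia.
apply: exec_seq; first by apply: exec_dec; rewrite // f4 subn_gt0.
rewrite f4 -/g; apply: exec_seq.
  apply: exec_to.
    apply: (@exec_le _ _ _ _ _ (g 1 * 6).+1); first by rewrite g1.
    by apply: (@exec_move nregs x isT); rewrite /= ?inE ?rm ?r5' ?r1.
  by rewrite g1 -/h.
apply: (@exec_le _ _ _ _ _ (h 5 * 5).+1); first by rewrite h5.
apply: exec_to; first by apply: (@exec_move nregs x isT).
apply: st_ext => j; rewrite h5 /h /transfer !inE.
case: (eqVneq j 1) => [->|j1].
  by rewrite g1 r1' /f /upd /= r1' /=; lia.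
case: (eqVneq j 5) => [->|j5].
  by rewrite g5 /f /upd /= r5' e5 /=; lia.
case: (eqVneq j 4) => [->|j4].
  by rewrite r4' /g /f /upd /=; lia.
rewrite /g /f /upd /= (negPf j4); case: (eqVneq j r) => _ /=; lia.
Qed.

Definition poly_le (f : nat -> nat) := exists p : {poly nat}, forall n, f n <= p.[n]%R.

Fixpoint Horner (r : nat) (s : seq nat) : rprog :=
  if s is c :: s then Seq (Horner r s) (Seq (Mult r) (Add r c)) else Skip _ _.

Lemma poly_nat_le (p : {poly nat}) a b : a <= b -> p.[a]%R <= p.[b]%R.
Proof.
move=> le_ab; rewrite /horner; elim: (polyseq p) => //= c s IH.
by rewrite leq_add // leq_mul.
Qed.

Section PolyLe.
Implicit Types f g : nat -> nat.

Lemma poly_le_cst c : poly_le (fun=> c).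
Proof. by exists (c%:P)%R => n; rewrite hornerC. Qed.

Lemma poly_le_id : poly_le id.
Proof. by exists 'X%R => n; rewrite hornerX. Qed.

Lemma poly_le_horner (p : {poly nat}) : poly_le (fun n => p.[n]%R).
Proof. by exists p. Qed.

Lemma poly_leD f g : poly_le f -> poly_le g -> poly_le (fun n => f n + g n).
Proof.
by move=> [p fp] [q gq]; exists (p + q)%R => n; rewrite hornerD leq_add.
Qed.

Lemma poly_leM f g : poly_le f -> poly_le g -> poly_le (fun n => f n * g n).
Proof.
by move=> [p fp] [q gq]; exists (p * q)%R => n; rewrite hornerM leq_mul.
Qed.

End PolyLe.

Lemma exec_horner r s : 1 < r < 4 ->
  exists2 T, poly_le T & forall x e out, e r = 0 -> e 4 = 0 -> e 5 = 0 ->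
    exec (Horner r s) (rst x e out) (rst x (upd e r (horner_rec s (e 1))) out) (T (e 1)).
Proof.
move=> hr; have rm : r < nregs by rewrite /nregs; lia.
elim: s => [|c s [T Tp IH]].
  exists (fun=> 1); first exact: poly_le_cst.
  move=> x e out er _ _; apply: exec_to (exec_skip _) _; apply: st_ext => i.
  by rewrite /upd; case: eqP => [->|].
exists (fun n => T n + (horner_rec s n * (11 * n + 10) + 2 + c.+1)).
  apply: poly_leD => //; apply: poly_leD; last exact: poly_le_cst.
  apply: poly_leD; last exact: poly_le_cst.
  apply: poly_leM; last first.
    apply: poly_leD; last exact: poly_le_cst.
    by apply: poly_leM; [exact: poly_le_cst | exact: poly_le_id].
  exists (Poly s) => n; rewrite leq_eqVlt; apply/orP; left; apply/eqP.
  elim: s {Tp IH} => [|a s IH] /=; first by rewrite horner0.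
  by rewrite horner_cons IH.
move=> x e out er e4 e5; have [r1 r4 r5] : [/\ 1 == r = false, 4 == r = false & 5 == r = false] by split; lia.
have E1 := IH x e out er e4 e5; set e1 := upd _ _ _ in E1.
have e11 : e1 1 = e 1 by rewrite /e1 /upd r1.
have e1r : e1 r = horner_rec s (e 1) by rewrite /e1 /upd eqxx.
have [e14 e15] : e1 4 = 0 /\ e1 5 = 0 by rewrite /e1 /upd r4 r5.
have E2 := exec_mult x out hr e14 e15.
rewrite e11 e1r in E2.
apply: exec_to; first by apply: exec_seq E1 (exec_seq E2 (exec_add _ _ _ _ rm)).
apply: st_ext => i; rewrite /e1 /upd /= !eqxx.
by case: eqP => // ->; rewrite eqxx.
Qed.

(** * Marking the registers, measuring the input, rewinding the output *)

Definition init_act (rd : reads nregs unit) : action nregs unit :=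
  fun i => (if (i == 0 :> nat) || (i == nregs :> nat) then rd i else mark, Stay).

Definition initial_store (x : seq bool) : store nregs unit :=
  fun i => (fun=> None, bits unit (nth [::] [:: x] i)).

Lemma exec_init x :
  exec (Act init_act) (initial_store x) (rst x (fun=> 0) [::]) 1.
Proof.
have -> : rst x (fun=> 0) [::] =
    vact (initial_store x) (init_act (vreads (initial_store x))).
  apply/funext => i; rewrite /vact /init_act /st /vreads ffunE /initial_store.
  case: (eqVneq (i : nat) 0) => [->|i0] /=; first by congr (_, _); apply/funext => -[].
  have -> : nth [::] [:: x] i = [::] by case: (i : nat) i0 => // j _; rewrite /= nth_nil.
  case: (eqVneq (i : nat) nregs) => [_|_] /=; congr (_, _); apply/funext => -[|j] //=.
exact: exec_act.
Qed.

(** The first loop counts the bits up to the blank after the input; the second brings the head back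
    to position 0; the third restores the count, which the second consumed. *)
Definition Scan : rprog :=
  Seq (Transfer (fun rd => rd ord0 != None) [:: 0; 1] [::])
      (Seq (Move _ 1 [:: 4] [:: 0]) (Move _ 4 [:: 1] [::])).

Lemma exec_scan x :
  exec Scan (rst x (fun=> 0) [::]) (rst x (upd (fun=> 0) 1 (size x)) [::])
    (16 * size x + 3).
Proof.
set n := size x; pose e0 : regs := fun=> 0.
have E1 : exec (Transfer (fun rd => rd ord0 != None) [:: 0; 1] [::])
    (rst x e0 [::]) (rst x (transfer e0 [:: 0; 1] [::] n) [::]) (n * 5).+1.
  apply: (@exec_transfer nregs x isT) => // i le_in; rewrite reads0.
  rewrite /transfer /= add0n muln1 muln0 subn0.
  case: ltnP => [lt|le]; first by rewrite bits_nth.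
  by rewrite bits_default.
set e1 := transfer _ _ _ _ in E1.
have e11 : e1 1 = n by rewrite /e1 /transfer /= add0n muln1 muln0 subn0.
have E2 : exec (Move _ 1 [:: 4] [:: 0]) (rst x e1 [::])
    (rst x (transfer e1 [:: 4] [:: 1; 0] (e1 1)) [::]) (e1 1 * 6).+1.
  by apply: (@exec_move nregs x isT) => // s; rewrite inE => /eqP ->.
rewrite e11 in E2; set e2 := transfer _ _ _ _ in E2.
have e24 : e2 4 = n by rewrite /e2 /e1 /transfer /= !muln0 !muln1 !subn0.
have E3 : exec (Move _ 4 [:: 1] [::]) (rst x e2 [::])
    (rst x (transfer e2 [:: 1] [:: 4] (e2 4)) [::]) (e2 4 * 5).+1.
  by apply: (@exec_move nregs x isT).
rewrite e24 in E3.
apply: exec_le; last apply: exec_to (exec_seq E1 (exec_seq E2 E3)) _; first by lia.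
apply: st_ext => r; rewrite /e2 /e1 /e0 /transfer /upd !inE.
by case: r => [|[|[|[|[|r]]]]] /=; rewrite ?mul0n ?muln0 //; lia.
Qed.

(** The head rests on the blank after the output, so it steps left once before the loop, which then
    stops on the blank before the first bit. *)
Definition Rewind : rprog :=
  Seq (Shift nregs nregs MoveL)
      (Seq (While (fun rd => rd ord_max != None) (Shift nregs nregs MoveL)) (Shift nregs nregs MoveR)).

Lemma exec_rewind x e w : exists2 v,
  exec Rewind (rst x e w) v (2 * size w + 3) &
  forall i, (v ord_max).2 i = bits unit w i.
Proof.
(* The view from the blank just before the word, a position that [word_view] cannot express. *)
pose pre : view unit := (fun=> None, fun i => if i is j.+1 then bits unit w j else None).
pose f j := if j is j.+1 then word_view w j else pre.
pose S j : store nregs unit := fun i => if i == nregs :> nat then f j else rst x e w i.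
have shiftL j : exec (Shift nregs nregs MoveL) (S j.+1) (S j) 1.
  have -> : S j = vact (S j.+1) (@shift_act nregs nregs MoveL (vreads (S j.+1))).
    apply/funext => i; rewrite /vact /shift_act /vreads ffunE /S.
    case: ifP => _; last by symmetry; apply: vstep_id.
    case: j => [|j]; rewrite [LHS]/= [RHS]/=.
      by congr (_, _); apply/funext => -[|[|i']].
    by rewrite -(word_view_dec w j) /= addn0.
  exact: exec_act.
have shiftR : exec (Shift nregs nregs MoveR) (S 0) (S 1) 1.
  have -> : S 1 = vact (S 0) (@shift_act nregs nregs MoveR (vreads (S 0))).
    apply/funext => i; rewrite /vact /shift_act /vreads ffunE /S.
    case: ifP => _; last by symmetry; apply: vstep_id.
    by rewrite [LHS]/= [RHS]/=; congr (_, _); apply/funext => -[|i'].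
  exact: exec_act.
exists (S 1); last by move=> i; rewrite /S /= ?eqxx.
have -> : rst x e w = S (size w).+1.
  apply/funext => i; rewrite /S /st.
  by case: (eqVneq (i : nat) nregs) => // ->.
apply: (@exec_le _ _ _ _ _ (1 + ((size w * 2).+1 + 1))); first by lia.
apply: exec_seq (shiftL _) (exec_seq _ shiftR).
have := @exec_while _ _ (fun i => S (size w - i)) (fun rd => rd ord_max != None)
  (Shift nregs nregs MoveL) (size w) 1.
rewrite subn0 subnn; apply.
  move=> i lt; have -> : size w - i = (size w - i.+1).+1 by lia.
  split => //; rewrite ffunE /S /= ?eqxx /= addn0 bits_nth //; lia.
by rewrite ffunE /S /= ?eqxx.
Qed.

Lemma poly_time_emits (q b : {poly nat}) (p : rprog) (o : seq bool -> seq nat -> seq bool)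
    (T : nat -> nat) :
  poly_le T ->
  (forall x, emits x (size x) q.[size x]%R b.[size x]%R p 0 (o x) (T (size x))) ->
  poly_time (fun x => o x [::]).
Proof.
move=> Tp Hp.
have [Tq Tqp Eq] := @exec_horner 2 (polyseq q) isT.
have [Tb Tbp Eb] := @exec_horner 3 (polyseq b) isT.
have [t le_t] : poly_le (fun n => 1 + ((16 * n + 3) + (Tq n + (Tb n + (T n + (2 * T n + 3)))))).
  by do ![apply: poly_leD | apply: poly_leM | exact: poly_le_cst | exact: poly_le_id | done].
exists (machine_of (Seq (Act init_act) (Seq Scan (Seq (Horner 2 q) (Seq (Horner 3 b)
  (Seq p Rewind)))))), t => x.
set n := size x in Hp *.
have [szo Ep] := Hp x [::] [::] erefl isT.
pose e1 := upd (fun=> 0) 1 n; pose e2 := upd e1 2 q.[n]%R.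
have E2 : exec (Horner 2 q) (rst x e1 [::]) (rst x e2 [::]) (Tq n) by apply: Eq.
have E3 : exec (Horner 3 b) (rst x e2 [::]) (rst x (upd e2 3 b.[n]%R) [::]) (Tb n).
  exact: Eb.
have eE : upd e2 3 b.[n]%R = env n q.[n]%R b.[n]%R [::].
  apply/funext => r; rewrite /upd /e2 /e1 /upd /env.
  by case: r => [|[|[|[|r]]]] //=; rewrite if_same.
rewrite eE in E3.
have [v E4 out] := exec_rewind x (env n q.[n]%R b.[n]%R [::]) (o x [::]).
apply: machine_of_halts out (le_t _); rewrite -/n.
apply: exec_seq (exec_init x) (exec_seq (exec_scan x) (exec_seq E2 (exec_seq E3 (exec_seq Ep _)))).
apply: exec_le E4; rewrite leq_add2r leq_mul2l; exact: szo.
Qed.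

(** * Computation tableaux *)

(* What a local constraint may depend on for two cells (t, z) and (t', z'). *)
Record profile := Profile {
  same_t : bool; next_t : bool;
  same_z : bool; next_z : bool; prev_z : bool;
  z_0 : bool; z'_0 : bool; z'_1 : bool;
  t_0 : bool; t_last : bool;
  z_cert : bool; x_true : bool; x_false : bool }.

Definition profile_of (x : seq bool) (Q B t z t' z' : nat) : profile :=
  Profile (t == t') (t.+1 == t') (z == z') (z.+1 == z') (z'.+1 == z)
    (z == 0) (z' == 0) (z' == 1) (t == 0) (t.+1 == B) (z < Q)
    (bits unit x z == Some (inl true)) (bits unit x z == Some (inl false)).

Section Tableau.
Variable M : machine.
Notation symb := (sym (aux M)).
Notation row := {ffun 'I_(tapes M).+1 -> symb}.

(* The cell (t, z) of the tableau holds the state and the scanned symbols at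
   time t, and for each tape the symbols at distance z from the head: on the left
   (where z = 0 is the nearest cell) and on the right (where z = 0 is the scanned
   one). *)
Definition cell : finType := (state M * row * row * row)%type.
Definition cst (g : cell) : state M := g.1.1.1.
Definition scan (g : cell) : row := g.1.1.2.
Definition lft (g : cell) : row := g.1.2.
Definition rgt (g : cell) : row := g.2.

(** A halting state keeps its configuration, as in [step], so the tableau may have more rows than
    the computation has steps. *)
Definition act (q : state M) (r : row) : state M * ('I_(tapes M).+1 -> symb * move) :=
  if halting q then (q, fun i => (r i, Stay)) else trans q r.

(** The equations of [vstep], the primed symbols being those at distance [z'] after the step. A move
    shifts one half of the tape away from the head and the other towards it. *)
Definition move_ok (p : profile) (a : symb * move) (l s l' s' : symb) : bool :=
  match a.2 with
  | MoveL => [&& prev_z p ==> (l' == l), (z_0 p && z'_0 p) ==> (s' == l),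
                 z'_1 p ==> (s' == a.1) & (next_z p && ~~ z_0 p) ==> (s' == s)]
  | MoveR => [&& next_z p ==> (l' == l), z'_0 p ==> (l' == a.1)
               & prev_z p ==> (s' == s)]
  | Stay => [&& same_z p ==> (l' == l), z'_0 p ==> (s' == a.1)
              & (same_z p && ~~ z_0 p) ==> (s' == s)]
  end.

Definition cert_symbol (s : symb) : bool := if s is Some (inr _) then false else true.

Definition initial_ok (p : profile) (g : cell) : bool :=
  (cst g == start M) &&
  [forall i : 'I_(tapes M).+1, (lft g i == None) &&
    (if i == 0 :> nat then
       rgt g i == (if x_true p then Some (inl true)
                   else if x_false p then Some (inl false) else None)
     else if i == 1 :> nat then
       cert_symbol (rgt g i) && (~~ z_cert p ==> (rgt g i == None))
     else rgt g i == None)].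

(** In this order: a row has one state and one tuple of scanned symbols; the scanned symbols are
    those at distance 0; row 0 is initial, with a guessed word on tape 1, where only blanks follow a
    blank; the last row accepts; consecutive rows obey the machine. *)
Definition good (p : profile) (g g' : cell) : bool :=
  [&& same_t p ==> (cst g == cst g') && (scan g == scan g'),
      z_0 p ==> (rgt g == scan g),
      t_0 p ==> initial_ok p g && ((same_t p && next_z p) ==>
        [forall i : 'I_(tapes M).+1, (i == 1 :> nat) ==> (rgt g i == None) ==> (rgt g' i == None)]),
      (t_last p && z_0 p) ==> (rgt g ord_max == Some (inl true))
    & next_t p ==> (cst g' == (act (cst g) (scan g)).1) &&
        [forall i, move_ok p ((act (cst g) (scan g)).2 i)
                     (lft g i) (rgt g i) (lft g' i) (rgt g' i)]].

Section Computation.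
Variables (x y : seq bool).

Definition conf (t : nat) : config M := iter t (@step M) (initial M [:: x; y]).
Definition conf_view (t : nat) (i : 'I_(tapes M).+1) : view (aux M) :=
  view_of (ctape (conf t) i).
Definition scanned (t : nat) : row := [ffun i => (conf_view t i).2 0].

Lemma confS t :
  cstate (conf t.+1) = (act (cstate (conf t)) (scanned t)).1 /\
  forall i, conf_view t.+1 i =
    vstep (conf_view t i) ((act (cstate (conf t)) (scanned t)).2 i).1
      ((act (cstate (conf t)) (scanned t)).2 i).2.
Proof.
rewrite /conf_view /= -/(conf t) /step /act.
have -> : [ffun i => tread (ctape (conf t) i)] = scanned t.
  by apply/ffunP => i; rewrite !ffunE tread_view.
case: ifP => _.
  split=> // i; transitivity (vstep (conf_view t i) (scanned t i) Stay) => //.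
  by rewrite ffunE; symmetry; apply: vstep_id.
by case: (trans _ _) => q a /=; split=> // i; rewrite view_of_step.
Qed.

Lemma conf_view0 i : conf_view 0 i = (fun=> None, bits (aux M) (nth [::] [:: x; y] i)).
Proof. by rewrite /conf_view /= view_of_load. Qed.

Lemma conf_viewE t i : conf_view t i = view_of (ctape (conf t) i).
Proof. by []. Qed.

Opaque conf_view.

Definition true_cell (t z : nat) : cell :=
  (cstate (conf t), scanned t, [ffun i => (conf_view t i).1 z],
   [ffun i => (conf_view t i).2 z]).

Definition accepts_at (t : nat) : Prop := (conf_view t ord_max).2 0 = Some (inl true).

Lemma true_cell_good Q B t z t' z' :
  size y <= Q -> accepts_at B.-1 ->
  good (profile_of x Q B t z t' z') (true_cell t z) (true_cell t' z').
Proof.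
move=> yQ acc; rewrite /good /cst /scan /lft /rgt /=; apply/and5P; split.
- by apply/implyP => /eqP->; rewrite !eqxx.
- by apply/implyP => /eqP->.
- apply/implyP => /eqP->; apply/andP; split.
  rewrite /initial_ok /cst /lft /rgt /= eqxx /=; apply/forallP => i.
  rewrite !ffunE conf_view0 /=.
  case: (eqVneq (i : nat) 0) => [->|i0] /=.
    case: (ltnP z (size x)) => [lt|le]; last by do 2 rewrite bits_default //.
    by do 2 rewrite bits_nth //; case: (nth false x _).
  case: (eqVneq (i : nat) 1) => [->|i1] /=.
    apply/andP; split.
      by case: (ltnP z (size y)) => [/bits_nth|/bits_default] ->.
    by apply/implyP; rewrite -leqNgt => le; rewrite bits_default // (leq_trans yQ).
  by case: (i : nat) i0 i1 => [|[|j]] // _ _; rewrite /= nth_nil /bits nth_nil.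
  apply/implyP => /andP[/eqP <- /eqP <-].
  apply/forallP => i; apply/implyP => /eqP i1; rewrite !ffunE conf_view0 i1 /=.
  apply/implyP; case: (ltnP z (size y)) => [lt|le]; first by rewrite bits_nth.
  by move=> _; rewrite bits_default // leqW.
- by apply/implyP => /andP[/eqP EB /eqP z0]; rewrite ffunE z0; apply/eqP; rewrite -acc -EB.
- apply/implyP => /eqP <-; have [-> cv] := confS t; rewrite eqxx /=.
  apply/forallP => i; rewrite !ffunE cv /move_ok.
  case: ((act _ _).2 i) => w [] /=.
  + apply/and4P; split; apply/implyP.
    * by move=> /eqP <-.
    * by move=> /andP[/eqP-> /eqP->].
    * by move=> /eqP->.
    * by move=> /andP[/eqP <-]; case: z.
  + apply/and3P; split; apply/implyP.
    * by move=> /eqP <-.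
    * by move=> /eqP->.
    * by move=> /eqP <-.
  + apply/and3P; split; apply/implyP.
    * by move=> /eqP <-.
    * by move=> /eqP->.
    * by move=> /andP[/eqP <-]; case: z.
Qed.

(** A move can bring contents one cell closer to the head, so a cell at distance [z] may depend on
    distance [z.+1] one row earlier. As the tableau is cut off at distance [B], only the triangle
    [t + z < B] is controlled; it contains the accepting cell [(B.-1, 0)]. *)
Lemma good_true_cell (Q B : nat) (D : nat -> nat -> cell) :
  (forall i : 'I_(tapes M).+1, i = 1 :> nat -> forall z, z < B ->
     rgt (D 0 z) i = bits (aux M) y z) ->
  (forall t z t' z', t < B -> z < B -> t' < B -> z' < B ->
     good (profile_of x Q B t z t' z') (D t z) (D t' z')) ->
  forall t z, t + z < B -> D t z = true_cell t z.
Proof.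
move=> Dy Dgood.
have cellP g g' : cst g = cst g' -> scan g = scan g' -> (forall i, lft g i = lft g' i) ->
    (forall i, rgt g i = rgt g' i) -> g = g'.
  by case: g g' => [[[q r] l] s] [[[q' r'] l'] s']; rewrite /cst /scan /lft /rgt /= => -> -> /ffunP-> /ffunP->.
have rule t z t' z' (lt : t < B) (lz : z < B) (lt' : t' < B) (lz' : z' < B) :=
  and5P (Dgood t z t' z' lt lz lt' lz').
have ctl t z : t < B -> z < B -> cst (D t z) = cst (D t 0) /\ scan (D t z) = rgt (D t 0).
  move=> lt lz; have B0 : 0 < B by apply: leq_ltn_trans lz.
  have [+ _ _ _ _] := rule t z t 0 lt lz lt B0.
  rewrite /= eqxx /= => /andP[/eqP-> /eqP->]; split=> //.
  by have [_ /= /eqP] := rule t 0 t 0 lt B0 lt B0.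
elim=> [|t IH] z ltB.
  have B0 : 0 < B by apply: leq_ltn_trans ltB.
  have row0 w : w < B -> [/\ cst (D 0 w) = start M, forall i, lft (D 0 w) i = None
      & forall i, rgt (D 0 w) i = bits (aux M) (nth [::] [:: x; y] i) w].
    move=> lw; have [_ _ + _ _] := rule 0 w 0 0 B0 lw B0 B0.
    rewrite /= => /andP[/andP[/eqP-> /forallP H] _]; split=> // i.
      by have /andP[/eqP] := H i.
    have /andP[_] := H i.
    case: (eqVneq (i : nat) 0) => [->|i0] /=.
      move/eqP->; case: (ltnP w (size x)) => [lt|le]; last by do 2 rewrite bits_default //.
      by do 2 rewrite bits_nth //; case: (nth false x _).
    case: (eqVneq (i : nat) 1) => [i1 _|i1] /=; first by rewrite Dy // i1.
    by move=> /eqP->; case: (i : nat) i0 i1 => [|[|j]] // _ _; rewrite /= nth_nil /bits nth_nil.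
  have [c1 c2] := ctl 0 z B0 ltB; have [d1 d2 d3] := row0 z ltB; have [e1 e2 e3] := row0 0 B0.
  apply: cellP => /= [||i|i]; rewrite ?ffunE ?conf_view0 ?d2 ?d3 //.
  by rewrite c2; apply/ffunP => i; rewrite ffunE e3 conf_view0.
have lt : t.+1 < B by apply: leq_ltn_trans ltB; apply: leq_addr.
have next w w' : w + t < B -> w' < B -> cst (D t.+1 w') = (act (cstate (conf t)) (scanned t)).1 /\
    forall i, move_ok (profile_of x Q B t w t.+1 w') ((act (cstate (conf t)) (scanned t)).2 i)
       ((conf_view t i).1 w) ((conf_view t i).2 w) (lft (D t.+1 w') i) (rgt (D t.+1 w') i).
  move=> lw lw'.
  have [_ _ _ _ +] := rule t w t.+1 w' (ltnW lt) (leq_ltn_trans (leq_addr _ _) lw) lt lw'.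
  rewrite /= eqxx /= IH 1?addnC //= => /andP[/eqP-> /forallP H]; split=> // i.
  by have := H i; rewrite !ffunE.
have [cS vS] := confS t.
have half w : t.+1 + w < B -> forall i,
    lft (D t.+1 w) i = (conf_view t.+1 i).1 w /\ rgt (D t.+1 w) i = (conf_view t.+1 i).2 w.
  move=> lw i; rewrite vS.
  have H u : u + t < B -> _ := fun lu => (next u w lu ltac:(lia)).2 i.
  move: H; rewrite /move_ok; case: ((act _ _).2 i) => a [] /= H.
  - split.
      by have /and4P[] := H w.+1 ltac:(lia); rewrite eqxx /= => /eqP.
    case: w lw H => [|[|w]] lw H.
    + by have /and4P[_ /= /eqP] := H 0 ltac:(lia).
    + by have /and4P[_ _ /= /eqP] := H 0 ltac:(lia).
    + by have /and4P[_ _ _ /=] := H w.+1 ltac:(lia); rewrite eqxx => /eqP.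
  - split; last by have /and3P[_ _] := H w.+1 ltac:(lia); rewrite eqxx /= => /eqP.
    case: w lw H => [|w] lw H; first by have /and3P[_ /= /eqP] := H 0 ltac:(lia).
    by have /and3P[] := H w ltac:(lia); rewrite eqxx /= => /eqP.
  - split; first by have /and3P[] := H w ltac:(lia); rewrite eqxx /= => /eqP.
    case: w lw H => [|w] lw H; first by have /and3P[_ /= /eqP] := H 0 ltac:(lia).
    by have /and3P[_ _] := H w.+1 ltac:(lia); rewrite eqxx /= => /eqP.
have zB : z < B by apply: leq_ltn_trans ltB; apply: leq_addl.
have B0 : 0 < B by apply: leq_ltn_trans zB.
have [c1 c2] := ctl t.+1 z lt zB.
apply: cellP => /= [||i|i].
- have [-> _] := next 0 z ltac:(lia) zB; by rewrite -cS.
- by rewrite c2; apply/ffunP => i; rewrite ffunE (half 0 _ i).2 //; lia.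
- by rewrite ffunE (half z ltB i).1.
- by rewrite ffunE (half z ltB i).2.
Qed.
End Computation.

(** Below [B] only blanks follow a blank, so the bits form an initial segment and their maximal word
    misses none. *)
Lemma bits_bit_prefix (A : finType) (g : nat -> sym A) Q B :
  (forall z, z < B -> if g z is Some (inr _) then false else true) ->
  (forall z, Q <= z < B -> g z = None) ->
  (forall z, z.+1 < B -> g z = None -> g z.+1 = None) ->
  forall z, z < B -> bits A (bit_prefix (mkseq g Q)) z = g z.
Proof.
elim: Q g B => [|Q IH] g B cg gQ gN z zB; first by rewrite gQ // /bits nth_nil.
have -> : mkseq g Q.+1 = g 0 :: mkseq (g \o succn) Q.
  by rewrite /mkseq /= (iotaDl 1 0) -map_comp.
have B0 : 0 < B by apply: leq_ltn_trans zB.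
move: (cg 0 B0); case E : (g 0) => [[b|//]|] _ /=; last first.
  rewrite /bits nth_nil; elim: z zB => [|z IHz] zB; first by rewrite E.
  by rewrite gN // -IHz // ltnW.
case: z zB => [|z] zB; first by rewrite E.
have zB' : z < B.-1 by lia.
rewrite -[RHS]/((g \o succn) z); apply: (IH _ B.-1) => // [w wB|w wB|w wB] /=.
- by apply: cg; lia.
- by apply: gQ; lia.
- by apply: gN; lia.
Qed.

Lemma size_bit_prefix (A : finType) (s : seq (sym A)) : size (bit_prefix s) <= size s.
Proof. by elim: s => //= -[[b|a]|] s IH. Qed.

Lemma tableauP x Q B : 0 < B ->
  (exists D : nat -> nat -> cell, forall t z t' z', t < B -> z < B -> t' < B -> z' < B ->
     good (profile_of x Q B t z t' z') (D t z) (D t' z')) <->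
  (exists2 y, size y <= Q & accepts_at x y B.-1).
Proof.
move=> B0; split=> [[D Dgood]|[y yQ acc]]; last first.
  by exists (true_cell x y) => t z t' z' _ _ _ _; apply: true_cell_good.
(* For a machine with a single tape [inord 1] defaults to tape 0; the requirement on tape 1 is then
   vacuous and any word of size at most [Q] serves. *)
pose g z := rgt (D 0 z) (inord 1).
exists (bit_prefix (mkseq g Q)).
  by apply: leq_trans (size_bit_prefix _) _; rewrite size_mkseq.
have DE := @good_true_cell x (bit_prefix (mkseq g Q)) Q B D _ Dgood.
have B1 : B.-1 < B by lia.
have /and5P[_ _ _ + _] := Dgood B.-1 0 B.-1 0 B1 B0 B1 B0.
rewrite /= DE ?addn0 // => [|i i1 z zB]; last first.
  have inord_i : inord 1 = i by apply: val_inj; rewrite /= inordK -?i1.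
  rewrite /g inord_i (@bits_bit_prefix _ _ _ B) // => w wB.
  - have /and5P[_ _ + _ _] := Dgood 0 w 0 w B0 wB B0 wB.
    rewrite /= => /andP[/andP[_ /forallP/(_ i) H] _]; move: H.
    by rewrite i1 /= => /andP[_ /andP[]].
  - have /andP[Qw wB'] := wB; have /and5P[_ _ + _ _] := Dgood 0 w 0 w B0 wB' B0 wB'.
    rewrite /= => /andP[/andP[_ /forallP/(_ i) H] _]; move: H.
    by rewrite i1 /= -leqNgt Qw => /andP[_ /andP[_ /eqP]].
  - move=> gw; have /and5P[_ _ + _ _] := Dgood 0 w 0 w.+1 B0 (ltnW wB) B0 wB.
    rewrite /= eqxx /= => /andP[_ /forallP/(_ i)].
    by rewrite i1 gw /= => /eqP.
by rewrite prednK // eqxx /= ffunE => /eqP.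
Qed.
End Tableau.

(** * Assignments under binary constraints as independent sets *)

Section Assignment.
Variables (C K : finType) (k0 : K) (ok : rel (C * K)%type).

Definition clash : rel (C * K)%type :=
  fun u v => ~~ ok u v || (u.1 == v.1) && (u.2 != v.2).

(** An independent set projects injectively to [C], hence onto [C] once it has [#|C|] elements. The
    vertices with content [k0] express the number [#|C|] as the size of a set of vertices. *)
Lemma clashP :
  (exists S : {set (C * K)%type},
     #|[pred u : C * K | u.2 == k0]| <= #|S| /\ {in S &, forall u v, ~~ clash u v}) <->
  (exists D : C -> K, forall c c', ok (c, D c) (c', D c')).
Proof.
have -> : #|[pred u : C * K | u.2 == k0]| = #|C|.
  rewrite -(card_imset predT (f := fun c : C => (c, k0))) => [|c c' [] //].
  apply: eq_card => -[c k]; rewrite !inE /=; apply/eqP/imsetP => [->|[c' _ [_ ->]] //].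
  by exists c.
split=> [[S [leS indS]]|[D Dok]].
  have injS : {in S &, injective fst}.
    move=> u v uS vS uv; have := indS u v uS vS.
    rewrite /clash negb_or uv eqxx /= !negbK => /andP[_ /eqP].
    by move: uv; case: u v {uS vS} => [c k] [c' k'] /= -> ->.
  have onto c : exists k, (c, k) \in S.
    have : c \in [set u.1 | u in S].
      have /eqP -> : [set u.1 | u in S] == setT by rewrite eqEcard subsetT cardsT card_in_imset.
      by rewrite inE.
    by case/imsetP => -[c' k] uS /= ->; exists k.
  have [D Dc] := choice onto; exists D => c c'.
  by have := indS _ _ (Dc c) (Dc c'); rewrite /clash negb_or negbK => /andP[].
exists [set (c, D c) | c in C]; split.
  by rewrite card_imset // => c c' [].
move=> u v /imsetP[c _ ->] /imsetP[c' _ ->].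
by rewrite /clash /= Dok /=; case: (eqVneq c c') => [->|//]; rewrite eqxx.
Qed.
End Assignment.

(** * The reduction *)

Section Pairs.
Variables (S T : eqType).

Definition pairs (s : seq S) (t : seq T) := [seq (x, y) | x <- s, y <- t].

Lemma pairs_uniq s t : uniq s -> uniq t -> uniq (pairs s t).
Proof. by move=> us ut; apply: allpairs_uniq => // -[x y] [x' y'] _ _ /= [-> ->]. Qed.

Lemma mem_pairs s t x y : ((x, y) \in pairs s t) = (x \in s) && (y \in t).
Proof.
apply/allpairsP/andP => [[[x' y'] [xs yt [-> ->]]]|[xs yt]] //.
by exists (x, y).
Qed.

Lemma flatten_pairs (U : Type) (F : S * T -> seq U) s t :
  flatten [seq F w | w <- pairs s t] =
  flatten [seq flatten [seq F (x, y) | y <- t] | x <- s].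
Proof.
elim: s => //= x s IH.
by rewrite /pairs /= map_cat flatten_cat -map_comp IH.
Qed.
End Pairs.

Lemma map_iota_ord (B : nat) (U : Type) (F : nat -> U) :
  [seq F i | i <- iota 0 B] = [seq F (i : 'I_B) | i <- enum 'I_B].
Proof. by rewrite -val_enum_ord -map_comp. Qed.

Section Vertices.
Variables (x : seq bool) (n Q B : nat) (St : finType).

(** The order of the nested loops: the coordinates come first, and the static part, over which the
    program is unrolled, varies fastest. *)
Definition vertices : seq ('I_B * 'I_B * 'I_B * 'I_B * St) :=
  let e := enum 'I_B in pairs (pairs (pairs (pairs e e) e) e) (enum St).

Definition coords (w : 'I_B * 'I_B * 'I_B * 'I_B * St) : seq nat :=
  let: (a, b, c, e, _) := w in [:: a : nat; b : nat; c : nat; e : nat].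

Definition Vertices (d : nat) (p : St -> rprog) : rprog :=
  For d (For d.+1 (For d.+2 (For d.+3 (Each (enum St) p)))).

Definition for_time (T : nat) : nat := B * T + 18 * B + 5.
Definition vertices_time (T : nat) : nat :=
  for_time (for_time (for_time (for_time (#|St| * T + 1)))).

Lemma emits_vertices d p o T : d <= 4 ->
  (forall k : St, emits x n Q B (p k) (d + 4) (o k) T) ->
  emits x n Q B (Vertices d p) d
    (fun cs => flatten [seq o w.2 (cs ++ coords w) | w <- vertices]) (vertices_time T).
Proof.
rewrite !addnS addn0 => d4 H.
have H1 := @emits_each x n Q B _ (enum St) p _ o T H.
rewrite -cardE in H1.
have lt3 : d.+3 < 8 by lia.
have lt2 : d.+2 < 8 by lia.
have lt1 : d.+1 < 8 by lia.
have lt0 : d < 8 by lia.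
have := emits_for lt0 (emits_for lt1 (emits_for lt2 (emits_for lt3 H1))).
congr emits; apply/funext => cs; rewrite /vertices !flatten_pairs.
rewrite map_iota_ord; congr flatten; apply: eq_map => a.
rewrite map_iota_ord; congr flatten; apply: eq_map => b.
rewrite map_iota_ord; congr flatten; apply: eq_map => c.
rewrite map_iota_ord; congr flatten; apply: eq_map => e.
by congr flatten; apply: eq_map => k /=; rewrite -!cats1 -!catA.
Qed.

(** Register 1 is excepted because the input length may exceed [B]. *)
Lemma env_le cs r : Q <= B -> all (ltn^~ B) cs -> r != 1 -> env n Q B cs r <= B.
Proof.
move=> QB /allP cB r1; rewrite /env (negPf r1).
do 3 case: ifP => // _; case: ifP => // lt; case: ifP => _; first by lia.
by apply/ltnW/cB/mem_nth.
Qed.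

Lemma emits_tests d l k o T (rs := [:: 2; 3; 7; 8; 10; 12; 14; 16; 18; 20; 22]) :
  Q <= B -> all (valid rs) l ->
  (forall val, emits x n Q B (k val) d (o val) T) ->
  emits x n Q B (Tests l (fun=> false) k) d
    (fun cs => o (fun s => (s \in l) && holds x (env n Q B cs) s) cs)
    (T + size l * (12 * B + 18)).
Proof.
move=> QB vl H cs out sz cB.
have [le E] := H (fun s => (s \in l) && holds x (env n Q B cs) s) cs out sz cB.
split; first by apply: leq_trans le (leq_addr _ _).
apply: (exec_tests (rs := rs)) vl _ => //.
by apply/allP => r rin; rewrite env_le // ?andbT; move: rin;
  rewrite !inE; do 10 (case/orP; [by move/eqP-> |]); move/eqP->.
Qed.
End Vertices.

(* Registers 2, 3 and 7 hold Q, B and 0; the even registers from 8 to 22 hold the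
   coordinates of a pair of vertices of the gadget. *)
Definition tests : seq test :=
  let rs := [:: 2; 3; 7; 8; 10; 12; 14; 16; 18; 20; 22] in
  [seq t <- pairs (pairs [:: 0; 1] rs) rs | t.1.2 != t.2] ++
  pairs (pairs [:: 2] rs) [:: 0; 1].

(** * Adjacency in terms of the outcomes of tests *)

Section TestedGraph.
Variable M : machine.
Notation K := (cell M).
Variable g0 : K.
Variable val : test -> bool.

Definition t_eq a b := val (0, a, b) && val (0, b, a).

(** Comparisons with 0, [B] and [Q] go through the registers 7, 3 and 2; [z < Q] is the negation of
    [Q <= z]. *)
Definition t_profile (t z t' z' : nat) : profile :=
  Profile (t_eq t t') (val (1, t, t')) (t_eq z z') (val (1, z, z')) (val (1, z', z))
    (t_eq z 7) (t_eq z' 7) (val (1, 7, z')) (t_eq t 7) (val (1, t, 3))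
    (~~ val (0, 2, z)) (val (2, z, 1)) (val (2, z, 0)).

(* A vertex is given by the registers of its coordinates and its static part. *)
Definition t_vertex : Type := ((nat * nat * K) * (nat * nat * K) * option bool)%type.

Definition t_same (u v : nat * nat * K) : bool :=
  [&& t_eq u.1.1 v.1.1, t_eq u.1.2 v.1.2 & u.2 == v.2].

Definition t_clash (u v : nat * nat * K) : bool :=
  ~~ good (t_profile u.1.1 u.1.2 v.1.1 v.1.2) u.2 v.2 ||
  [&& t_eq u.1.1 v.1.1, t_eq u.1.2 v.1.2 & u.2 != v.2].

Definition t_arc (s t : t_vertex) : bool :=
  match s.2, t.2 with
  | Some false, Some true => t_same s.1.1 t.1.1 && t_same s.1.2 t.1.2
  | Some b, None => [&& t_clash s.1.1 s.1.2, t_same t.1.1 t.1.2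
                      & t_same t.1.1 (if b then s.1.2 else s.1.1)]
  | _, _ => false
  end.

Definition t_counted (s : t_vertex) : bool :=
  if s.2 is Some b then ~~ b else ~~ t_same s.1.1 s.1.2 || (s.1.1.2 == g0).
End TestedGraph.

Section Reduction.
Variables (M : machine) (x : seq bool) (Q B : nat).
Notation K := (cell M).
Notation St := (K * K * option bool)%type.

Definition tab_ok : rel ('I_B * 'I_B * K) := fun u v =>
  good (profile_of x Q B u.1.1 u.1.2 v.1.1 v.1.2) u.2 v.2.

Definition reduced : sgraph := gadget (clash tab_ok).

Definition vertex_of (w : 'I_B * 'I_B * 'I_B * 'I_B * St) : reduced :=
  let: (a, b, c, e, (k, k', o)) := w in (((a, b), k), ((c, e), k'), o).

Lemma vertices_enum : perm_eq [seq vertex_of w | w <- vertices B St] (enum reduced).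
Proof.
apply: uniq_perm; last 1 first.
- move=> s; rewrite mem_enum; apply/mapP.
  case: s => [[[[a b] k] [[c e] k']] o]; exists (a, b, c, e, (k, k', o)) => //.
  by rewrite /vertices !mem_pairs !mem_enum.
- rewrite map_inj_uniq.
    by rewrite /vertices !pairs_uniq ?enum_uniq.
  by move=> [[[[a b] c] e] [[k k'] o]] [[[[a' b'] c'] e'] [[l l'] o']] [] -> -> -> -> -> -> ->.
- exact: enum_uniq.
Qed.
End Reduction.

(** The registers are the loop variables of depths [d] to [d + 3]. *)
Definition t_vertex_at (M : machine) (d : nat) (k : (cell M * cell M * option bool)%type) :
    t_vertex M :=
  ((8 + d.*2, 10 + d.*2, k.1.1), (12 + d.*2, 14 + d.*2, k.1.2), k.2).
Arguments t_vertex_at M d k : clear implicits.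

Section Agreement.
Variables (M : machine) (g0 : cell M) (x : seq bool) (Q B : nat).
Variable e : regs.
Hypotheses (e2 : e 2 = Q) (e3 : e 3 = B) (e7 : e 7 = 0).
Let val := holds x e.
Notation V := ('I_B * 'I_B * cell M)%type.

Definition denotes1 (u : nat * nat * cell M) (u' : V) : Prop :=
  [/\ e u.1.1 = u'.1.1, e u.1.2 = u'.1.2 & u.2 = u'.2].

Definition denotes (s : t_vertex M) (s' : reduced M x Q B) : Prop :=
  [/\ denotes1 s.1.1 s'.1.1, denotes1 s.1.2 s'.1.2 & s.2 = s'.2].

Lemma t_eqE a b : t_eq val a b = (e a == e b).
Proof. by rewrite /t_eq /= -eqn_leq. Qed.

Lemma t_sameE u v u' v' : denotes1 u u' -> denotes1 v v' -> t_same val u v = (u' == v').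
Proof.
move=> [a1 a2 a3] [b1 b2 b3]; rewrite /t_same !t_eqE a1 a2 a3 b1 b2 b3.
by case: u' v' {a1 a2 a3 b1 b2 b3} => [[a b] k] [[c d] l]; rewrite !xpair_eqE andbA.
Qed.

Lemma t_clashE u v u' v' : denotes1 u u' -> denotes1 v v' ->
  t_clash val u v = clash (@tab_ok M x Q B) u' v'.
Proof.
move=> [a1 a2 a3] [b1 b2 b3]; rewrite /t_clash /clash /tab_ok; congr (~~ good _ _ _ || _) => //.
  by rewrite /t_profile /profile_of !t_eqE e7 /= e7 e2 e3 a1 a2 b1 b2 -ltnNge [1 == _]eq_sym.
rewrite !t_eqE a1 a2 a3 b1 b2 b3.
by case: u' v' {a1 a2 a3 b1 b2 b3} => [[a b] k] [[c d] l]; rewrite !xpair_eqE andbA.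
Qed.

Lemma t_arcE s t s' t' : denotes s s' -> denotes t t' ->
  t_arc val s t = garc (clash (@tab_ok M x Q B)) s' t'.
Proof.
move=> [s1 s2 s3] [t1 t2 t3]; rewrite /t_arc /garc s3 t3.
case: (s'.2) => [[]|]; case: (t'.2) => [[]|] //.
- by rewrite (t_clashE s1 s2) (t_sameE t1 t2) (t_sameE t1 s2).
- by rewrite (t_sameE s1 t1) (t_sameE s2 t2).
- by rewrite (t_clashE s1 s2) (t_sameE t1 t2) (t_sameE t1 s1).
Qed.

Lemma t_countedE s s' : denotes s s' ->
  t_counted g0 val s = counted [pred u : V | u.2 == g0] s'.
Proof.
move=> [s1 s2 s3]; rewrite /t_counted /counted s3; case: (s'.2) => // .
by rewrite (t_sameE s1 s2) /=; case: s1 => _ _ ->.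
Qed.
End Agreement.

Section Restriction.
Variables (M : machine) (g0 : cell M) (val val' : test -> bool).
Hypothesis agree : forall t, t \in tests -> val t = val' t.

(** All tests consulted belong to [tests], outside of which the program has no outcomes. The two
    vertices sit at different depths, so that no register is compared with itself. *)
Lemma t_arc_agree_l (k k' : cell M * cell M * option bool) :
  t_arc val (t_vertex_at M 0 k) (t_vertex_at M 4 k') = t_arc val' (t_vertex_at M 0 k) (t_vertex_at M 4 k').
Proof.
case: k k' => [[k l] o] [[k' l'] o']; rewrite /t_vertex_at /t_arc /=.
by case: o o' => [[]|] [[]|] //; rewrite /t_same /t_clash /t_profile /t_eq /= !agree.
Qed.

Lemma t_arc_agree_r (k k' : cell M * cell M * option bool) :
  t_arc val (t_vertex_at M 4 k) (t_vertex_at M 0 k') = t_arc val' (t_vertex_at M 4 k) (t_vertex_at M 0 k').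
Proof.
case: k k' => [[k l] o] [[k' l'] o']; rewrite /t_vertex_at /t_arc /=.
by case: o o' => [[]|] [[]|] //; rewrite /t_same /t_clash /t_profile /t_eq /= !agree.
Qed.

Lemma t_counted_agree (k : cell M * cell M * option bool) :
  t_counted g0 val (t_vertex_at M 0 k) = t_counted g0 val' (t_vertex_at M 0 k).
Proof.
case: k => [[k l] o]; rewrite /t_vertex_at /t_counted /=.
by case: o => [[]|] //; rewrite /t_same /t_eq /= !agree.
Qed.
End Restriction.

(** * The program of the reduction *)

Section Program.
Variable M : machine.
Variable g0 : cell M.
Notation St := (cell M * cell M * option bool)%type.

Definition AdjProgram (k k' : St) : rprog :=
  Tests tests (fun=> false) (fun val =>
    Emit nregs (t_arc val (t_vertex_at M 0 k) (t_vertex_at M 4 k') ||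
                t_arc val (t_vertex_at M 4 k') (t_vertex_at M 0 k))).

Definition CountProgram (k : St) : rprog :=
  Tests tests (fun=> false) (fun val =>
    if t_counted g0 val (t_vertex_at M 0 k) then Emit nregs true else Skip _ _).

Definition reduction : rprog :=
  Seq (Vertices 0 (fun _ : St => Emit nregs true))
 (Seq (Emit nregs false)
 (Seq (Vertices 0 (fun k => Vertices 4 (AdjProgram k)))
      (Vertices 0 CountProgram))).

Definition reduction_word (x : seq bool) (Q B : nat) : seq bool :=
  let s := [seq @vertex_of M x Q B w | w <- vertices B St] in
  nseq (size s) true ++ false :: [seq adj u v | u <- s, v <- s] ++
  nseq #|counted [pred u : 'I_B * 'I_B * cell M | u.2 == g0]| true.

Lemma nseq_flatten (I : Type) (s : seq I) (c : pred I) :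
  flatten [seq if c i then [:: true] else [::] | i <- s] = nseq (count c s) true.
Proof. by elim: s => //= i s ->; case: (c i). Qed.

Lemma denotes_l (x : seq bool) n Q B cs (w : 'I_B * 'I_B * 'I_B * 'I_B * St) :
  denotes (env n Q B (coords w ++ cs)) (t_vertex_at M 0 w.2) (@vertex_of M x Q B w).
Proof. by case: w => [[[[a b] c] e] [[k l] o]]. Qed.

Lemma denotes_r (x : seq bool) n Q B (w w' : 'I_B * 'I_B * 'I_B * 'I_B * St) :
  denotes (env n Q B (coords w ++ coords w')) (t_vertex_at M 4 w'.2) (@vertex_of M x Q B w').
Proof. by case: w w' => [[[[a b] c] e] k] [[[[a' b'] c'] e'] [[k' l'] o']]. Qed.

Definition reduction_time (B : nat) : nat :=
  let Tt := 1 + size tests * (12 * B + 18) in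
  let V := vertices_time B St in V 1 + (1 + (V (V Tt) + V Tt)).

Lemma emits_reduction x n Q B : Q <= B ->
  exists2 o, emits x n Q B reduction 0 o (reduction_time B)
           & o [::] = reduction_word x Q B.
Proof.
move=> QB; have v_tests : all (valid [:: 2; 3; 7; 8; 10; 12; 14; 16; 18; 20; 22]) tests by [].
have E1 := @emits_vertices x n Q B St 0 (fun _ => Emit nregs true) (fun _ _ => [:: true]) 1
  isT (fun=> @emits_emit x n Q B true _).
have E2 := @emits_emit x n Q B false 0.
pose vals cs := fun s => (s \in tests) && holds x (env n Q B cs) s.
have H3 k k' := @emits_tests x n Q B 8 tests _ _ 1 QB v_tests (fun val =>
  @emits_emit x n Q B (t_arc val (t_vertex_at M 0 k) (t_vertex_at M 4 k') ||
                       t_arc val (t_vertex_at M 4 k') (t_vertex_at M 0 k)) 8).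
have E3 := emits_vertices (d := 0) isT (fun k => emits_vertices (d := 4) isT (H3 k)).
have H4 (k : St) : emits x n Q B (CountProgram k) 4
    (fun cs => if t_counted g0 (vals cs) (t_vertex_at M 0 k) then [:: true] else [::])
    (1 + size tests * (12 * B + 18)).
  apply: (emits_tests QB v_tests (T := 1) (o := fun val _ =>
    if t_counted g0 val (t_vertex_at M 0 k) then [:: true] else [::])) => val.
  by case: (t_counted _ _ _); [exact: emits_emit | exact: emits_skip].
have E4 := emits_vertices (d := 0) isT H4.
eexists; first exact: emits_seq E1 (emits_seq E2 (emits_seq E3 E4)).
have agree cs t : t \in tests -> (t \in tests) && holds x (env n Q B cs) t = holds x (env n Q B cs) t.
  by move->.
rewrite /reduction_word; congr (_ ++ (_ :: (_ ++ _))).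
- by rewrite size_map; elim: (vertices B St) => //= w l ->.
- rewrite allpairs_mapl allpairs_mapr; congr flatten; apply: eq_map => w.
  rewrite flatten_map1; apply: eq_map => w'.
  rewrite (t_arc_agree_l (agree _)) (t_arc_agree_r (agree _)) /= /gadj.
  have dl := @denotes_l x n Q B (coords w') w; have dr := @denotes_r x n Q B w w'.
  by rewrite (t_arcE _ _ _ dl dr) ?(t_arcE _ _ _ dr dl).
- have -> : #|counted [pred u : 'I_B * 'I_B * cell M | u.2 == g0]| =
    count (counted [pred u : 'I_B * 'I_B * cell M | u.2 == g0]) (enum (reduced M x Q B)).
    by rewrite cardE -size_filter enumT.
  rewrite -(permP (vertices_enum M x Q B)) count_map -nseq_flatten.
  congr flatten; apply: eq_map => w; rewrite (t_counted_agree _ (agree _)).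
  have := @denotes_l x n Q B [::] w; rewrite cats0 => dl.
  by rewrite (t_countedE _ dl).
Qed.
End Program.

Lemma accepts_atP (M : machine) x y (b : bool) t0 t :
  halts_in M t0 [:: x; y] [:: b] -> t0 <= t -> accepts_at M x y t <-> b.
Proof.
move=> [halted out] le_t; rewrite /accepts_at conf_viewE /conf.
rewrite (iter_step_le le_t halted) /=; move: out; rewrite /output.
case: (tright _) => [|[[b'|a]|] s] //= [-> _].
by split=> [[->]|->].
Qed.

Lemma gadget_tree_param (f : sgraph -> nat) (T : finType) (R : rel T) c :
  (forall (G : sgraph) (v : G), f (del_vertex v) <= f G <= f (del_vertex v) + 1) ->
  (forall G, edgeless G -> f G <= c) -> tree_param f (gadget R) <= c + 4.
Proof.
move=> f_del fc; apply: tree_param_le (gadget_decomposition R) _ => -[[u v]|].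
  by apply: leq_trans (f_le_card f_del _ fc) _; rewrite leq_add2l card_gbag.
by apply: leq_trans (leq_addr _ _); apply: fc; apply: gbag_edgeless.
Qed.

(** * Correctness and running time for a given verifier *)

Section Hardness.
Variables (V : seq bool -> seq bool -> bool) (q p : {poly nat}) (M : machine).
Hypothesis verifier : forall x y, halts_in M p.[size x + size y]%R [:: x; y] [:: V x y].

(** Row [B - 1] must not precede the halt for any certificate of size at most [Q]. The summand [q]
    gives [Q <= B], used in the time bound of the tests, and 1 gives [0 < B]. *)
Let bound : {poly nat} := (p \Po ('X + q) + q + 1)%R.
Let g0 : cell M := (start M, [ffun=> None], [ffun=> None], [ffun=> None]).
Let Q (x : seq bool) : nat := q.[size x]%R.
Let B (x : seq bool) : nat := bound.[size x]%R.

Lemma boundE n : bound.[n]%R = p.[(n + q.[n]%R)%N]%R + q.[n]%R + 1.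
Proof. by rewrite /bound !hornerD horner_comp hornerD hornerX hornerC. Qed.

Definition hard_word (x : seq bool) : seq bool := reduction_word g0 x (Q x) (B x).

Lemma hard_word_poly_time : poly_time hard_word.
Proof.
have QB n : q.[n]%R <= bound.[n]%R by rewrite boundE -addnA addnCA leq_addr.
have [o Ho] := choice (fun x =>
  let: ex_intro2 o E H := @emits_reduction M g0 x (size x) (Q x) (B x) (QB _) in
  ex_intro (fun o => emits x (size x) (Q x) (B x) (reduction g0) 0 o (reduction_time M (B x))
     /\ o [::] = hard_word x) o (conj E H)).
have -> : hard_word = fun x => o x [::] by apply/funext => x; rewrite (Ho x).2.
apply: (@poly_time_emits q bound (reduction g0) o (fun n => reduction_time M bound.[n]%R)).
  have Bp := poly_le_horner bound; have cst := poly_le_cst.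
  have loop_poly f : poly_le f -> poly_le (fun n => for_time bound.[n]%R (f n)).
    by move=> fp; apply: poly_leD (poly_leD (poly_leM Bp fp) (poly_leM (cst _) Bp)) (cst _).
  have vP (S : finType) f : poly_le f -> poly_le (fun n => vertices_time bound.[n]%R S (f n)).
    by move=> fp; rewrite /vertices_time; do 4! apply: (loop_poly); apply: poly_leD (poly_leM (cst _) fp) (cst _).
  have testp : poly_le (fun n => 1 + size tests * (12 * bound.[n]%R + 18)).
    exact: poly_leD (cst _) (poly_leM (cst _) (poly_leD (poly_leM (cst _) Bp) (cst _))).
  apply: poly_leD; first exact/vP/cst.
  by apply: poly_leD (cst _) (poly_leD _ _); [exact/vP/vP | exact/vP].
by move=> x; apply: (Ho x).1.
Qed.

Lemma hard_word_correct x :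
  #|counted [pred u : 'I_(B x) * 'I_(B x) * cell M | u.2 == g0]|
     <= alpha (reduced M x (Q x) (B x)) <->
  (exists2 y, size y <= q.[size x]%R & V x y).
Proof.
have B0 : 0 < B x by rewrite /B boundE addn1.
rewrite gadget_alpha; apply: (iff_trans (clashP g0 (@tab_ok M x (Q x) (B x)))).
apply: (@iff_trans _ (exists2 y, size y <= Q x & accepts_at M x y (B x).-1)); last first.
  have acc y : size y <= Q x -> accepts_at M x y (B x).-1 <-> V x y.
    move=> yQ; apply: accepts_atP (verifier x y) _.
    rewrite /B boundE addn1 /=; apply: leq_trans (leq_addr _ _).
    by apply: poly_nat_le; rewrite leq_add2l.
  by split=> -[y yQ /(acc y yQ)]; exists y.
rewrite -tableauP //; split=> [[D Dok]|[D Dok]].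
  (* The value of [ord] outside the range is a default; constraints are imposed only below [B x]. *)
  pose ord t : 'I_(B x) := insubd (Ordinal B0) t.
  exists (fun t z => D (ord t, ord z)) => t z t' z' lt lz lt' lz'.
  by have := Dok (ord t, ord z) (ord t', ord z'); rewrite /tab_ok /= !insubdK.
by exists (fun c : 'I_(B x) * 'I_(B x) => D c.1 c.2) => c c'; apply: Dok.
Qed.

Lemma hard_word_enc x : mis_enc (hard_word x)
  (reduced M x (Q x) (B x), #|counted [pred u : 'I_(B x) * 'I_(B x) * cell M | u.2 == g0]|).
Proof. by eexists; [apply: vertices_enum|]. Qed.
End Hardness.

Theorem theorem18 (f : sgraph -> nat)
  (f_invariant : graph_invariant f)
  (f_del : forall (G : sgraph) (v : G),
     f (del_vertex v) <= f G <= f (del_vertex v) + 1) :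
  (exists g : nat -> nat,
     forall G : sgraph, tree_param alpha G <= g (tree_param f G)) \/
  para_NP_hard mis_enc mis_yes (fun i => tree_param f i.1).
Proof.
case: (alpha_dichotomy f_invariant f_del) => [[g Hg]|[c Hc]].
  by left; exists (fun m => \max_(i < m.+1) g i); apply: tree_alpha_le.
right; exists (c + 4) => L [V [q [[M [p verifier]] LV]]].
exists (hard_word q p M); first exact: hard_word_poly_time.
move=> x; eexists; split; first exact: hard_word_enc.
  by rewrite /=; apply: gadget_tree_param f_del Hc.
by apply: iff_trans (LV x) (iff_sym _); apply: hard_word_correct verifier _.
Qed.
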